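(* Let $p$ be a constant and let $q$ be a measurable function on $\mathbb{R}^n$ with $0<p\le q(x)\le \overline q<\infty$. Let $v$ and $w$ be weights on $\mathbb{R}^n$. Then the inequality $$\|Gf\|_{L_{q(\cdot),w}(\mathbb{R}^n)}\le C\,\|f\|_{L_{p,v}(\mathbb{R}^n)}$$ holds, with a finite constant $C>0$ independent of $f$, for every measurable $f>0$ on $\mathbb{R}^n$ if and only if there exists $s>1$ such that $$D(s,p,q)=\sup_{t>0}|B(0,t)|^{\frac{s-1}{p}}\left\|\frac{w(\cdot)}{|B(0,|\cdot|)|^{\frac sp}}\exp\left(\frac1{|B(0,|\cdot|)|}\int_{B(0,|\cdot|)}\ln\frac1{v(y)}\,dy\right)\right\|_{L_{q(\cdot)}(|x|>t)}<\infty .$$ Moreover, if $C>0$ is the best possible constant in the inequality, then $$\sup_{s>1}\frac{e^{\frac sp}}{\left(e^s+\frac1{s-1}\right)^{1/p}}\,D(s,p,q)\le C\le\left(\frac p{\underline q}+\frac{\overline q-p}{\overline q}\right)^{\frac2p}\inf_{s>1}e^{\frac{s-1}p}\,D(s,p,q).$$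
   Context: A weight on a measurable set $\Omega\subset\mathbb{R}^n$ is a measurable, non-negative, almost everywhere positive function on $\Omega$. For a measurable exponent $q$ on $\Omega$ with $0<\underline q\le q(x)<\infty$ and a weight $\omega$ on $\Omega$, set $$\|f\|_{L_{q(\cdot),\omega}(\Omega)}=\inf\left\{\lambda>0:\ \int_\Omega\left|\frac{f(x)\omega(x)}{\lambda}\right|^{q(x)}dx\le1\right\},$$ and write $L_{q(\cdot)}(\Omega)$ when $\omega=1$. For a constant exponent $p$ this gives $\|f\|_{L_{p,v}(\mathbb{R}^n)}=\left(\int_{\mathbb{R}^n}|f(x)v(x)|^p\,dx\right)^{1/p}$. Here $\underline q=\operatorname{ess\,inf}q$ and $\overline q=\operatorname{ess\,sup}q$. $B(0,r)=\{y\in\mathbb{R}^n:|y|<r\}$, $|B(0,r)|$ is its Lebesgue measure, and $L_{q(\cdot)}(|x|>t)$ is the space on $\{x\in\mathbb{R}^n:|x|>t\}$. The multidimensional geometric mean operator is, for $f>0$, $$Gf(x)=\exp\left(\frac1{|B(0,|x|)|}\int_{B(0,|x|)}\ln f(y)\,dy\right).$$ *)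

(* Defs.v *)
From HB Require Import structures.
From mathcomp Require Import all_boot all_order all_algebra.
From mathcomp Require Import all_classical all_reals all_analysis ess_sup_inf.

Set Implicit Arguments.
Unset Strict Implicit.
Unset Printing Implicit Defensive.

Import Order.TTheory GRing.Theory Num.Theory.
Import numFieldNormedType.Exports.

Local Open Scope classical_set_scope.
Local Open Scope ring_scope.

(** * Lebesgue measure on R^(n+1)

    The library has no n-dimensional Lebesgue measure.  We take the textbook
    outer measure, the infimum of the total volumes of countable covers by
    closed boxes, and apply the library's Caratheodory construction to it:
    "measurable" below therefore means Lebesgue measurable.  The dimension is
    written [n.+1] because in dimension 0 no box has volume 0. *)

Section lebesgue_outer_measure.
Context {R : realType} {n : nat}.
Implicit Types (A : set 'rV[R]_n.+1) (c : 'rV[R]_n.+1 * 'rV[R]_n.+1).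

Definition box c : set 'rV[R]_n.+1 :=
  [set x | forall i, c.1 ord0 i <= x ord0 i <= c.2 ord0 i].

Definition box_vol c : R := \prod_(i < n.+1) (c.2 ord0 i - c.1 ord0 i).

Definition box_cover A : set (nat -> 'rV[R]_n.+1 * 'rV[R]_n.+1) :=
  [set c : nat -> 'rV[R]_n.+1 * 'rV[R]_n.+1 |
           (forall k i, (c k).1 ord0 i <= (c k).2 ord0 i) /\
           A `<=` \bigcup_k box (c k)].

Local Open Scope ereal_scope.

Definition lebesgue_outer A : \bar R :=
  ereal_inf [set \sum_(k <oo) (box_vol (c k))%:E | c in box_cover A].

Lemma box_cover_vol_ge0 A (c : nat -> 'rV[R]_n.+1 * 'rV[R]_n.+1) k : box_cover A c -> 0 <= (box_vol (c k))%:E.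
Proof.
move=> [cle _]; rewrite lee_fin /box_vol.
by apply: prodr_ge0 => i _; rewrite subr_ge0.
Qed.

Lemma lebesgue_outer_ge0 A : 0 <= lebesgue_outer A.
Proof.
apply: le_ereal_inf_tmp => _ [c Ac <-].
by apply: nneseries_ge0 => k _ _; exact: box_cover_vol_ge0 Ac.
Qed.

Lemma lebesgue_outer0 : lebesgue_outer set0 = 0.
Proof.
apply/eqP; rewrite eq_le lebesgue_outer_ge0 andbT.
apply: ereal_inf_lbound; exists (fun=> (0%R, 0%R)); first by split.
apply: eseries0 => k _ _.
by rewrite /box_vol big_ord_recl !mxE subr0 mul0r.
Qed.

Lemma le_lebesgue_outer : {homo lebesgue_outer : A B / A `<=` B >-> A <= B}.
Proof.
move=> A B AB; apply: ereal_inf_le_tmp => _ [c [cle Bc] <-].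
by exists c => //; split => //; exact: subset_trans Bc.
Qed.

Lemma lebesgue_outer_sigma_subadditive : sigma_subadditive lebesgue_outer.
Proof.
move=> A; have [[i ioo]|] := pselect (exists i, lebesgue_outer (A i) = +oo).
  rewrite (eseries_pinfty _ _ ioo) ?leey// => k _.
  by rewrite -ltNye (lt_le_trans _ (lebesgue_outer_ge0 _)).
rewrite -forallNE => Aoo.
apply/lee_addgt0Pr => _/posnumP[e].
rewrite (le_trans _ (epsilon_trick _ _ _))//; last first.
  by move=> k; exact: lebesgue_outer_ge0.
pose P k (c : nat -> 'rV[R]_n.+1 * 'rV[R]_n.+1) := box_cover (A k) c /\
  \sum_(j <oo) (box_vol (c j))%:E <=
    lebesgue_outer (A k) + (e%:num / (2 ^ k.+1)%:R)%:E.
have [G PG] : {G & forall k, P k (G k)}.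
  apply: (@choice _ _ P) => k; rewrite /P /lebesgue_outer.
  set S := (X in ereal_inf X); move infS : (ereal_inf S) => iS.
  case: iS infS => [r Sr|Soo|Soo].
  - have ek : (0 < e%:num / (2 ^ k.+1)%:R)%R by [].
    have /(lb_ereal_inf_adherent ek) : ereal_inf S \is a fin_num by rewrite Sr.
    move=> [_ [c Ac <-]] xS.
    by exists c; split => //; rewrite -Sr; exact/ltW.
  - by have := Aoo k; rewrite /lebesgue_outer Soo.
  - by have := lebesgue_outer_ge0 (A k); rewrite /lebesgue_outer -/S Soo.
pose V (x : nat * nat) := (box_vol (G x.1 x.2))%:E.
have V0 x : 0 <= V x by exact: box_cover_vol_ge0 (PG x.1).1.
have /card_esym/ppcard_eqP[f] := card_nat2.
apply: (@le_trans _ _ (\esum_(x in setT) V x)).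
  apply: ereal_inf_lbound => /=; exists (fun k => G (f k).1 (f k).2).
    split => [k i|t [k _ Akt]]; first exact: (PG (f k).1).1.1.
    have [j _ Gt] := (PG k).1.2 t Akt.
    by exists (f^-1%FUN (k, j)) => //=; rewrite invK ?inE.
  rewrite nneseries_esumT//=; last by move=> k; exact: (V0 (f k)).
  by rewrite (@reindex_esum _ _ _ setT setT f V).
rewrite (_ : esum _ _ = \sum_(i <oo) \sum_(j <oo) V (i, j)); last first.
  rewrite nneseries_esumT; last by move=> i; apply: nneseries_ge0 => *.
  transitivity (\esum_(i in [set: nat]) \esum_(j in [set: nat]) V (i, j)).
    rewrite esum_esum//; congr esum.
    by rewrite predeqE => -[a b].
  by apply: eq_esum => i _; rewrite nneseries_esumT.
by apply: lee_nneseries => [i _ _|i _]; [exact: nneseries_ge0|exact: (PG i).2].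
Qed.

HB.instance Definition _ := isOuterMeasure.Build R 'rV[R]_n.+1 lebesgue_outer
  lebesgue_outer0 lebesgue_outer_ge0 le_lebesgue_outer
  lebesgue_outer_sigma_subadditive.

End lebesgue_outer_measure.

(* Points are row vectors; the sigma-algebra is that of Lebesgue. *)
Definition Rn (R : realType) (n : nat) : Type :=
  caratheodory_type (@lebesgue_outer R n).

HB.instance Definition _ (R : realType) (n : nat) :=
  Measurable.copy (Rn R n)
    (caratheodory_type (@lebesgue_outer R n : {outer_measure set _ -> \bar R})).

Definition lebesgue_n (R : realType) (n : nat) : set (Rn R n) -> \bar R :=
  @lebesgue_outer R n.
Arguments lebesgue_n : clear implicits.

HB.instance Definition _ (R : realType) (n : nat) :=
  isMeasure.Build _ (Rn R n) R (lebesgue_n R n)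
    (caratheodory_measure0 (@lebesgue_outer R n))
    (caratheodory_measure_ge0 (mu := @lebesgue_outer R n))
    (caratheodory_measure_sigma_additive (mu := @lebesgue_outer R n)).

(** * Norms, balls and weights *)

(* The library norm on row vectors is the max norm, hence this definition. *)
Definition enorm {R : realType} {n : nat} (x : Rn R n) : R :=
  Num.sqrt (\sum_(i < n.+1) (x : 'rV[R]_n.+1) ord0 i ^+ 2).

Definition eball {R : realType} {n : nat} (r : R) : set (Rn R n) :=
  [set y | enorm y < r].

Definition vball {R : realType} (n : nat) (r : R) : R :=
  fine (lebesgue_n R n (eball r)).

Definition weight {R : realType} {n : nat} (Omega : set (Rn R n))
    (omega : Rn R n -> R) : Prop :=
  [/\ measurable_fun Omega omega,
      (forall x, Omega x -> 0 <= omega x) &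
      {ae lebesgue_n R n, forall x, Omega x -> 0 < omega x}].

Local Open Scope ereal_scope.

(* The functions are extended real valued because [geomean f] can be infinite;
   the norm is +oo when no lambda is admissible. *)
Definition vnorm {R : realType} {n : nat} (Omega : set (Rn R n))
    (q omega : Rn R n -> R) (f : Rn R n -> \bar R) : \bar R :=
  ereal_inf [set lambda%:E | lambda in [set lambda : R | (0 < lambda)%R /\
    \int[lebesgue_n R n]_(x in Omega)
      (`| f x * (omega x)%:E * (lambda^-1)%:E | `^ q x) <= 1]].

Definition qinf {R : realType} {n : nat} (q : Rn R n -> R) : R :=
  fine (ess_inf (lebesgue_n R n) (fun x => (q x)%:E)).

Definition qsup {R : realType} {n : nat} (q : Rn R n -> R) : R :=
  fine (ess_sup (lebesgue_n R n) (fun x => (q x)%:E)).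

(** * The geometric mean operator

    The integral of [ln f] is extended real valued, [expeR] extending the
    exponential by [expeR -oo = 0] and [expeR +oo = +oo].  When both the
    positive and the negative part of [ln f] have infinite integral the
    integral is -oo, hence [geomean f x = 0]. *)
Definition geomean {R : realType} {n : nat} (f : Rn R n -> R) (x : Rn R n) :
    \bar R :=
  expeR (((vball n (enorm x))^-1)%:E *
         \int[lebesgue_n R n]_(y in eball (enorm x)) (ln (f y))%:E).

Definition geomean_ineq {R : realType} {n : nat} (p : R)
    (q v w : Rn R n -> R) (C : R) : Prop :=
  forall f : Rn R n -> R, measurable_fun setT f -> (forall x, 0 < f x)%R ->
    vnorm setT q w (geomean f) <=
    C%:E * vnorm setT (cst p) v (fun x => (f x)%:E).

Definition best_constant {R : realType} {n : nat} (p : R)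
    (q v w : Rn R n -> R) (C : R) : Prop :=
  [/\ (0 < C)%R, geomean_ineq p q v w C &
      forall C' : R, (0 < C')%R -> geomean_ineq p q v w C' -> (C <= C')%R].

Definition Dconst {R : realType} {n : nat} (s p : R) (q v w : Rn R n -> R) :
    \bar R :=
  ereal_sup [set ((vball n t) `^ ((s - 1) / p))%:E *
    vnorm [set x | (t < enorm x)%R] q (cst 1%R)
      (fun x => (w x / (vball n (enorm x)) `^ (s / p))%:E *
                geomean (fun y => (1 / v y)%R) x)
    | t in [set t : R | (0 < t)%R]].

(* Main.v *)
Require Import Defs.
From mathcomp Require Import all_boot all_order all_algebra.
From mathcomp Require Import all_classical all_reals all_analysis ess_sup_inf measurable_realfun.
From mathcomp Require Import ring lra.
From HB Require Import structures.

Set Implicit Arguments.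
Unset Strict Implicit.
Unset Printing Implicit Defensive.

Import Order.TTheory GRing.Theory Num.Theory.
Import numFieldNormedType.Exports.

Local Open Scope classical_set_scope.
Local Open Scope ring_scope.
Local Open Scope ereal_scope.

(** Write [V x] for the volume of the ball centred at the origin whose boundary
    passes through [x] ([radvol x] below), [alpha = (s - 1) / p], and [k] for the
    function [w / V^(s/p) * G(1/v)] whose norms over the sets [|x| > t] define
    [Dconst s p q v w].  Since [G f = G (f v) * G (1/v)], the inequality is one
    between [f v] in [L_p] and [G (f v)] weighted by [w * G (1/v)].

    If [Dconst s p q v w < D], normalise [f] so that [h = |f v|^p] has integral
    at most 1.  The geometric mean of [V^(s-1)] over the ball of volume [V x] is
    [e^-(s-1) (V x)^(s-1)]; inserting this power and using the concavity of the
    logarithm gives ([geomean_le])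
    << G f(x)^p <= e^(s-1) (V x)^(-s) (int_(|y|<|x|) h(y) V(y)^(s-1) dy) G(1/v)(x)^p. >>
    Since [h dy] has mass at most 1 and [q(x)/p >= 1], a second convexity
    inequality ([le_integral_powR]) moves the power [q(x)/p] under the integral,
    and Tonelli's theorem bounds the modular of [G f / (e^alpha D)] by
    << int h(y) (int_(|x|>|y|) (V(y)^alpha k(x) / D)^q(x) dx) dy <= int h <= 1, >>
    the inner integral being at most 1 because [Dconst < D]
    ([geomean_modular_le1]).  So [e^alpha D] is a constant for the inequality.
    The factor [(p / qinf q + (qsup q - p) / qsup q)^(2/p)] of the upper bound is
    at least 1 because [qinf q <= qsup q].

    For the converse, fix [t] and let [T] be the volume of the ball of radius
    [t].  The density [h] equal to [1/T] where [V < T] and to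
    [e^-s T^(s-1) V^-s] elsewhere has integral [1 + e^-s / (s-1)]
    ([integral_extremal]) and geometric mean exactly [T^(s-1) (V x)^-s] as soon
    as [|x| > t] ([integral_ln_extremal]).  Testing the inequality on
    [f = h^(1/p) / v] makes [w * G f] equal to [T^alpha k] on [|x| > t], so that
    [Dconst s p q v w <= C (1 + e^-s / (s-1))^(1/p)]
    ([geomean_ineq_Dconst]), which is the lower bound for [C].

    Both directions rest on the facts that [V] is measurable and that
    [{x | V x < a}] has measure [a] for [a > 0], so that integrals of functions of
    [V] reduce to integrals on the half-line ([layer_cake]).  The integral of
    [ln f] may be infinite on both sides, in which case [G f = 0]; splitting off
    an integrable part is still correct then ([integralD_total]). *)

(** * Coordinates are measurable *)

Section boxes.
Context {R : realType} {n : nat}.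
Implicit Types (c : 'rV[R]_n.+1 * 'rV[R]_n.+1).

Lemma lebesgue_outer_box_le c : (forall i, c.1 ord0 i <= c.2 ord0 i)%R ->
  lebesgue_outer (box c) <= (box_vol c)%:E.
Proof.
move=> cle.
pose s k := if k == 0%N then c else (0%R, 0%R).
apply: ereal_inf_lbound; exists s.
  split=> [[|k] i|x cx]; [exact: cle|by []|].
  by exists 0%N.
rewrite (nneseries_split _ 1%N)//; last first.
  move=> [|k] _; rewrite lee_fin /box_vol.
    by apply: prodr_ge0 => i _; rewrite subr_ge0.
  by apply: prodr_ge0 => i _; rewrite subr_ge0.
rewrite big_nat1 eseries0 ?adde0// => -[|k]// _ _.
by rewrite /box_vol big_ord_recl !mxE subr0 mul0r.
Qed.

Definition set_coord (x : 'rV[R]_n.+1) (i : 'I_n.+1) (a : R) : 'rV[R]_n.+1 :=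
  \row_j (if j == i then a else x ord0 j).

Definition clamp (a b t : R) := Num.max a (Num.min b t).

Lemma box_vol_split c i (m : R) :
  (box_vol c = box_vol (c.1, set_coord c.2 i m) +
               box_vol (set_coord c.1 i m, c.2))%R.
Proof.
have D d : box_vol d =
    ((d.2 ord0 i - d.1 ord0 i) * \prod_(j | j != i) (d.2 ord0 j - d.1 ord0 j))%R.
  by rewrite /box_vol (bigD1 i).
rewrite !D /= !mxE eqxx.
under [X in (_ = _ * X + _)%R]eq_bigr => j ji do rewrite mxE (negbTE ji).
under [X in (_ = _ + _ * X)%R]eq_bigr => j ji do rewrite mxE (negbTE ji).
by rewrite -mulrDl; congr (_ * _)%R; ring.
Qed.

(** A hyperplane orthogonal to an axis cuts each box of a cover into two boxes
    whose volumes add up. *)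
Lemma halfspace_caratheodory (i : 'I_n.+1) (a : R) :
  (@lebesgue_outer R n).-caratheodory [set x | (x ord0 i <= a)%R].
Proof.
apply: le_caratheodory_measurable => X.
apply: le_ereal_inf_tmp => _ [c [cle Xc] <-].
(* Clamping the cut [a] to the box also covers the boxes lying on one side of
   the hyperplane, for which one of the two pieces degenerates. *)
pose m k := clamp ((c k).1 ord0 i) ((c k).2 ord0 i) a.
have m1 k : ((c k).1 ord0 i <= m k)%R by rewrite /m /clamp le_max lexx.
have m2 k : (m k <= (c k).2 ord0 i)%R.
  by rewrite /m /clamp ge_max cle ge_min lexx.
pose lo k := ((c k).1, set_coord (c k).2 i (m k)).
pose hi k := (set_coord (c k).1 i (m k), (c k).2).
have lole k j : ((lo k).1 ord0 j <= (lo k).2 ord0 j)%R.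
  by rewrite mxE /=; case: eqP => [->|].
have hile k j : ((hi k).1 ord0 j <= (hi k).2 ord0 j)%R.
  by rewrite mxE /=; case: eqP => [->|].
have vol0 (d : 'rV[R]_n.+1 * 'rV[R]_n.+1) :
    (forall j, d.1 ord0 j <= d.2 ord0 j)%R -> 0 <= (box_vol d)%:E.
  by move=> h; rewrite lee_fin; apply: prodr_ge0 => j _; rewrite subr_ge0.
have -> : \sum_(k <oo) (box_vol (c k))%:E =
  \sum_(k <oo) (box_vol (lo k))%:E + \sum_(k <oo) (box_vol (hi k))%:E.
  rewrite -nneseriesD; last 2 first.
  - by move=> k _ _; exact: vol0.
  - by move=> k _ _; exact: vol0.
  by apply: eq_eseriesr => k _; rewrite (box_vol_split _ i (m k)) EFinD.
apply: leeD; apply: ereal_inf_lbound.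
- exists lo => //; split => // x [Xx xa].
  have [k _ ckx] := Xc _ Xx; exists k => // j.
  have /andP[h1 h2] := ckx j.
  rewrite /= mxE h1 /=; case: eqP => [ji|]//; rewrite ji in h1 h2 *.
  by rewrite /m /clamp le_max le_min h2 xa orbT.
- exists hi => //; split => // x [Xx /negP]; rewrite -ltNge => /ltW ax.
  have [k _ ckx] := Xc _ Xx; exists k => // j.
  have /andP[h1 h2] := ckx j.
  rewrite /= mxE h2 andbT; case: eqP => [ji|]//; rewrite ji in h1 h2 *.
  by rewrite /m /clamp ge_max h1 ge_min ax orbT.
Qed.

End boxes.

Section coordinates.
Context {R : realType} {n : nat}.

Lemma measurable_coord (i : 'I_n.+1) :
  measurable_fun [set: Rn R n] (fun x : Rn R n => (x : 'rV[R]_n.+1) ord0 i).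
Proof.
apply: (measurability _ (RGenOInfty.measurableE R)) => //.
move=> _ [_ [a ->] <-]; rewrite setTI.
have := caratheodory_measurable_setC (@halfspace_caratheodory R n i a).
congr (_ .-caratheodory); apply/seteqP; split => x /=.
  by move/negP; rewrite -ltNge in_itv/= andbT.
by rewrite in_itv/= andbT ltNge => /negP.
Qed.

Lemma measurable_enorm : measurable_fun [set: Rn R n] enorm.
Proof.
apply: (measurableT_comp (f := @Num.sqrt R)).
  by apply: continuous_measurable_fun; exact: sqrt_continuous.
by apply: measurable_sum => i; apply: measurable_funX; exact: measurable_coord.
Qed.

End coordinates.
(** * The unit cube has volume at least 1 *)

Section iterated_integrals.
Context {R : realType}.
Notation mu := (@lebesgue_measure R).

(** Integrating out one coordinate at a time turns a covering of the unit cube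
    by boxes, written as an inequality between indicator functions, into an
    inequality between volumes: each step is the countable additivity of the
    integral on the line. *)
Lemma cube_cover_ge1 (m : nat) (a b : nat -> nat -> R) (c : nat -> R) :
  (forall k, 0 <= c k)%R -> (forall k i, a k i <= b k i)%R ->
  (forall x : nat -> R, (forall i, 0 <= x i <= 1)%R ->
    1 <= \sum_(k <oo) (c k * \prod_(i < m) \1_`[a k i, b k i] (x i))%:E) ->
  1 <= \sum_(k <oo) (c k * \prod_(i < m) (b k i - a k i))%:E.
Proof.
elim: m c => [|m IH] c c0 ab H.
  have := H (fun=> 0%R) _; rewrite lexx ler01 => /(_ (fun=> isT)).
  by under eq_eseriesr do rewrite big_ord0; under [X in _ -> 1 <= X]eq_eseriesr do rewrite big_ord0.
have ba k : (0 <= b k m - a k m)%R by rewrite subr_ge0.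
suff : 1 <= \sum_(k <oo) ((c k * (b k m - a k m)) *
    \prod_(i < m) (b k i - a k i))%:E.
  move/le_trans; apply; rewrite le_eqVlt; apply/orP; left; apply/eqP.
  by apply: eq_eseriesr => k _; rewrite big_ord_recr/=; congr (_%:E); ring.
apply: IH => // [k|x x01]; first by rewrite mulr_ge0.
pose d k := (c k * \prod_(i < m) \1_`[a k i, b k i] (x i))%R.
have d0 k : (0 <= d k)%R.
  by rewrite mulr_ge0//; apply: prodr_ge0 => i _; rewrite indicE.
have Hd t : (0 <= t <= 1)%R ->
    1 <= \sum_(k <oo) (d k * \1_`[a k m, b k m] t)%:E.
  move=> t01; apply: le_trans (H (fun i => if i == m then t else x i) _) _.
    by move=> i; case: eqP.
  rewrite le_eqVlt; apply/orP; left; apply/eqP; apply: eq_eseriesr => k _.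
  rewrite big_ord_recr/= eqxx mulrA; congr (_ * _ * _)%:E.
  by apply: eq_bigr => i _; rewrite (ltn_eqF (ltn_ord i)).
have -> : 1 = \int[mu]_(t in `[0%R, 1%R]) (cst 1 t) :> \bar R.
  by rewrite integral_cst//= lebesgue_measure_itv/= lte_fin ltr01 sube0 mul1e.
have md k : measurable_fun [set: R] (fun t => (d k * \1_`[a k m, b k m] t)%:E).
  by apply/measurable_EFinP; apply: measurable_funM.
have dd k t : 0 <= (d k * \1_`[a k m, b k m] t)%:E.
  by rewrite lee_fin mulr_ge0// indicE.
apply: (@le_trans _ _ (\int[mu]_(t in `[0%R, 1%R])
    (\sum_(k <oo) (d k * \1_`[a k m, b k m] t)%:E))).
  apply: ge0_le_integral => //.
    apply: ge0_emeasurable_sum => [k t _ _|k _]; first exact: dd.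
    by apply: measurable_funTS; exact: md.
rewrite integral_nneseries; [|by []|by move=> k; apply: measurable_funTS; exact: md|by move=> k t _; exact: dd].
apply: lee_nneseries => [k _ _|k _]; first exact: integral_ge0.
apply: (@le_trans _ _ (\int[mu]_t (d k * \1_`[a k m, b k m] t)%:E)).
  by apply: ge0_subset_integral => //; exact: md.
under eq_integral do rewrite EFinM.
rewrite ge0_integralZl//; last 2 first.
- by apply/measurable_EFinP.
- by rewrite lee_fin.
rewrite integral_indic// setIT/= lebesgue_measure_itv/=.
rewrite [d k]lock lte_fin; case: ltP => h; rewrite -?EFinB -?EFinM lee_fin -lock /d.
  by rewrite le_eqVlt; apply/orP; left; apply/eqP; ring.
by rewrite mulr0 mulr_ge0 ?mulr_ge0//; apply: prodr_ge0 => i _; rewrite indicE.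
Qed.

End iterated_integrals.
(** * Volumes of balls *)

Section lebesgue_balls.
Context {R : realType} {n : nat}.
Implicit Types (x y : Rn R n) (r t : R).

Lemma lebesgue_outer_unit_cube :
  1 <= lebesgue_outer [set x : 'rV[R]_n.+1 | forall i, (0 <= x ord0 i <= 1)%R].
Proof.
apply: le_ereal_inf_tmp => _ [c [cle Ac] <-].
have := @cube_cover_ge1 R n.+1 (fun k i => (c k).1 ord0 (inord i))
  (fun k i => (c k).2 ord0 (inord i)) (fun=> 1%R).
move=> /(_ (fun=> ler01) (fun k i => cle k (inord i))) H.
apply: le_trans (H _) _ => [x x01|]; last first.
  rewrite le_eqVlt; apply/orP; left; apply/eqP; apply: eq_eseriesr => k _.
  rewrite mul1r /box_vol; congr (_%:E); apply: eq_bigr => i _.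
  by rewrite inord_val.
have [i|k _ ckx] := Ac (\row_i x i); first by rewrite mxE.
rewrite (nneseries_split _ k.+1)//; last first.
  by move=> i _; rewrite lee_fin mul1r; apply: prodr_ge0 => j _; rewrite indicE.
rewrite big_nat_recr//=.
have -> : (\prod_(i < n.+1) \1_`[(c k).1 ord0 (inord i), (c k).2 ord0 (inord i)]
    (x i) = 1 :> R)%R.
  apply: big1 => i _; rewrite indicE mem_set//= in_itv/= inord_val.
  by have := ckx i; rewrite mxE.
rewrite mulr1 -{1}[1]add0e -{1}[0+1]adde0; apply: leeD; last first.
  apply: nneseries_ge0 => i _ _.
  by rewrite lee_fin mul1r; apply: prodr_ge0 => j _; rewrite indicE.
apply: leeD => //; rewrite sumEFin lee_fin; apply: sumr_ge0 => i _.
by rewrite mul1r; apply: prodr_ge0 => j _; rewrite indicE.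
Qed.

Lemma lebesgue_outer_dilate_le t (A : set 'rV[R]_n.+1) : (0 < t)%R ->
  lebesgue_outer [set (t *: x)%R | x in A] <= (t ^+ n.+1)%:E * lebesgue_outer A.
Proof.
move=> t0; rewrite -lee_pdivrMl ?exprn_gt0//.
apply: le_ereal_inf_tmp => _ [c [cle Ac] <-].
rewrite lee_pdivrMl ?exprn_gt0// -nneseriesZl; last first.
  move=> k _; rewrite lee_fin.
  by apply: prodr_ge0 => i _; rewrite subr_ge0.
apply: ereal_inf_lbound; exists (fun k => ((t *: (c k).1)%R, (t *: (c k).2)%R)).
  split => [k i|_ [x Ax <-]]; first by rewrite !mxE ler_pM2l.
  have [k _ ckx] := Ac _ Ax; exists k => // i.
  by have := ckx i; rewrite !mxE !ler_pM2l.
apply: eq_eseriesr => k _; rewrite -EFinM; congr (_%:E).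
rewrite /box_vol (_ : t ^+ n.+1 = \prod_(i < n.+1) t)%R; last first.
  by rewrite prodr_const card_ord.
rewrite -big_split/=.
by apply: eq_bigr => i _; rewrite !mxE mulrBr.
Qed.

Lemma enorm_ge0 x : (0 <= enorm x)%R. Proof. exact: sqrtr_ge0. Qed.

Lemma enormZ t x : (0 <= t)%R ->
  enorm ((t *: (x : 'rV[R]_n.+1))%R : Rn R n) = (t * enorm x)%R.
Proof.
move=> t0; rewrite /enorm; under eq_bigr do rewrite mxE exprMn.
by rewrite -mulr_sumr sqrtrM ?exprn_ge0// sqrtr_sqr ger0_norm.
Qed.

Lemma measurable_eball r : measurable (@eball R n r).
Proof.
rewrite [X in measurable X](_ : _ = setT `&` enorm @^-1` `]-oo, r[); last first.
  by rewrite setTI; apply/seteqP; split => x /=; rewrite in_itv.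
exact: measurable_enorm.
Qed.

Lemma measurable_gt_enorm r : measurable [set x : Rn R n | (r < enorm x)%R].
Proof.
rewrite [X in measurable X](_ : _ = setT `&` enorm @^-1` `]r, +oo[); last first.
  by rewrite setTI; apply/seteqP; split => x /=; rewrite in_itv/= andbT.
exact: measurable_enorm.
Qed.

Lemma eball_dilate t r : (0 < t)%R ->
  @eball R n (t * r)%R = [set (t *: (x : 'rV[R]_n.+1))%R | x in @eball R n r].
Proof.
move=> t0; apply/seteqP; split => [x xtr|_ [x xr <-]]; last first.
  by rewrite /eball /= (enormZ _ (ltW t0)) ltr_pM2l.
exists (t^-1 *: (x : 'rV[R]_n.+1))%R; last first.
  by rewrite scalerA divff ?scale1r// gt_eqF.
rewrite /eball /= (enormZ _ _) ?invr_ge0 ?ltW//.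
by rewrite ltr_pdivrMl.
Qed.

Lemma lebesgue_eball_dilate t r : (0 < t)%R ->
  lebesgue_n R n (eball (t * r)%R) = (t ^+ n.+1)%:E * lebesgue_n R n (eball r).
Proof.
move=> t0; apply/eqP; rewrite eq_le; apply/andP; split.
  by rewrite eball_dilate//; exact: lebesgue_outer_dilate_le.
rewrite -lee_pdivlMl ?exprn_gt0//.
rewrite (_ : eball r = eball (t^-1 * (t * r))%R); last first.
  by rewrite mulrA mulVf ?mul1r// gt_eqF.
have ti : (0 < t^-1)%R by rewrite invr_gt0.
rewrite (eball_dilate _ ti) -exprVn; exact: lebesgue_outer_dilate_le.
Qed.

Lemma lebesgue_eball_fin_num r : lebesgue_n R n (eball r) \is a fin_num.
Proof.
rewrite ge0_fin_numE ?measure_ge0//.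
pose c : 'rV[R]_n.+1 * 'rV[R]_n.+1 := (const_mx (- `|r|), const_mx `|r|)%R.
apply: (@le_lt_trans _ _ (box_vol c)%:E); last by rewrite ltry.
apply: le_trans (lebesgue_outer_box_le _); last first.
  by move=> i; rewrite !mxE ge0_cp// ?normr_ge0.
apply: le_lebesgue_outer => x xr i; rewrite !mxE -ler_norml.
have xi : (x ord0 i ^+ 2 <= \sum_(i < n.+1) x ord0 i ^+ 2)%R.
  by rewrite (bigD1 i)//= lerDl; apply: sumr_ge0 => j _; exact: sqr_ge0.
rewrite -sqrtr_sqr; apply: le_trans (ler_wsqrtr xi) _.
by apply: le_trans (ltW xr) (ler_norm _).
Qed.

Lemma lebesgue_eballE r : lebesgue_n R n (eball r) = (vball n r)%:E.
Proof. by rewrite /vball fineK// lebesgue_eball_fin_num. Qed.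

Lemma vball_ge0 r : (0 <= @vball R n r)%R.
Proof. by rewrite -lee_fin -lebesgue_eballE measure_ge0. Qed.

Lemma vball_dilate t r : (0 < t)%R -> vball n (t * r)%R = (t ^+ n.+1 * vball n r)%R.
Proof.
by move=> t0; apply: EFin_inj; rewrite EFinM -!lebesgue_eballE lebesgue_eball_dilate.
Qed.

Lemma vball1_gt0 : (0 < @vball R n 1)%R.
Proof.
have n2 : (0 < n.+2%:R :> R)%R by [].
suff : (0 < @vball R n (n.+2%:R * 1))%R by rewrite vball_dilate// pmulr_rgt0// exprn_gt0.
rewrite -lte_fin -lebesgue_eballE mulr1.
apply: lt_le_trans lte01 _; apply: le_trans lebesgue_outer_unit_cube _.
apply: le_lebesgue_outer => x x01; rewrite /eball/=.
rewrite -[ltRHS](ger0_norm (ltW n2)) -sqrtr_sqr ltr_sqrt ?exprn_gt0//.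
apply: (@le_lt_trans _ _ (\sum_(i < n.+1) 1)%R).
  by apply: ler_sum => i _; have /andP[? ?] := x01 i; rewrite expr_le1.
rewrite sumr_const card_ord -natrX ltr_nat.
by rewrite expnS expn1 mulSn addnC ltn_addl// -[ltnLHS]muln1 ltn_mul.
Qed.

Lemma vball_le0 r : (r <= 0)%R -> @vball R n r = 0%R.
Proof.
move=> r0; rewrite /vball (_ : eball r = set0) ?measure0//.
apply/seteqP; split => // x /=; rewrite /eball/= => /lt_le_trans -/(_ _ r0).
by rewrite ltNge enorm_ge0.
Qed.

Lemma vballE r : (0 <= r)%R -> @vball R n r = (r ^+ n.+1 * vball n 1)%R.
Proof.
rewrite le_eqVlt => /predU1P[<-|r0]; first by rewrite vball_le0// expr0n mul0r.
by rewrite -{1}(mulr1 r) vball_dilate.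
Qed.

Lemma vball_gt0 r : (0 < @vball R n r)%R = (0 < r)%R.
Proof.
have [r0|r0] := leP r 0%R; first by rewrite vball_le0// ltxx.
by rewrite vballE ?(ltW r0)// mulr_gt0 ?exprn_gt0// vball1_gt0.
Qed.

Lemma ltr_vball r t : (0 <= r)%R -> (0 <= t)%R ->
  (@vball R n r < vball n t)%R = (r < t)%R.
Proof. by move=> r0 t0; rewrite (vballE r0) (vballE t0) ltr_pM2r ?vball1_gt0// ltr_pXn2r. Qed.

Lemma vball_surj (a : R) : (0 < a)%R -> exists2 r, (0 < r)%R & @vball R n r = a.
Proof.
move=> a0; exists ((a / vball n 1) `^ (n.+1%:R)^-1)%R.
  by rewrite powR_gt0// divr_gt0// vball1_gt0.
rewrite vballE ?powR_ge0// -powR_mulrn ?powR_ge0// -powRrM mulVf// powRr1.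
  by rewrite divfK// gt_eqF// vball1_gt0.
by rewrite divr_ge0 ?ltW// vball1_gt0.
Qed.

Lemma lebesgue_n_sigma_finite : sigma_finite setT (lebesgue_n R n).
Proof.
exists (fun k => eball k%:R).
  apply/seteqP; split => // x _; exists (Num.truncn (enorm x)).+1 => //.
  by rewrite /eball/=; exact: truncnS_gt.
move=> k; split; first exact: measurable_eball.
by rewrite -ge0_fin_numE ?lebesgue_eball_fin_num.
Qed.

Lemma lebesgue_n_setT_gt0 : 0 < lebesgue_n R n setT.
Proof.
apply: (@lt_le_trans _ _ (lebesgue_n R n (eball 1%R))).
  by rewrite lebesgue_eballE lte_fin vball1_gt0.
by apply: le_measure; rewrite ?inE//; exact: measurable_eball.
Qed.

End lebesgue_balls.

HB.instance Definition _ (R : realType) (n : nat) :=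
  @Measure_isSigmaFinite.Build _ _ _ (lebesgue_n R n) (@lebesgue_n_sigma_finite R n).

(** * Integrals on the line *)

Section line_integrals.
Context {R : realType}.
Notation mu := (@lebesgue_measure R).

Lemma integral_inv (a b : R) : (0 < a)%R -> (a < b)%R ->
  \int[mu]_(t in `[a, b]) (t^-1)%:E = (ln b - ln a)%:E.
Proof.
move=> a0 ab; rewrite EFinB.
have pos t : (a <= t)%R -> (0 < t)%R by exact: lt_le_trans.
apply: continuous_FTC2 => //.
- apply: (@derivable_within_continuous _ _ _ `[a, b]) => t.
  rewrite in_itv/= => /andP[/pos t0 _].
  by apply: derivableV; [rewrite gt_eqF|exact: derivable_id].
- have dln t : (0 < t)%R -> derivable (@ln R) t 1.
    by move=> t0; apply: ex_derive; exact: is_derive1_ln.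
  have cln t : (0 < t)%R -> {for t, continuous (@ln R)}.
    by move=> t0; apply/differentiable_continuous/derivable1_diffP/dln.
  split.
  + by move=> t; rewrite in_itv/= => /andP[/ltW/pos t0 _]; exact: dln.
  + by apply: cvg_at_right_filter; apply: cln.
  + by apply: cvg_at_left_filter; apply: cln; exact: lt_trans ab.
- move=> t; rewrite in_itv/= => /andP[/ltW/pos t0 _].
  by rewrite derive1E; have [_ ->] := is_derive1_ln t0.
Qed.

Lemma powRN_cvgy (e : R) : (0 < e)%R -> (t `^ (- e))%R @[t --> +oo%R] --> (0 : R)%R.
Proof.
move=> e0; apply/cvgrPdist_le => /= d d0.
near=> t.
have td : (d `^ (- e^-1) <= t)%R by near: t; apply: nbhs_pinfty_ge; rewrite num_real.
have m0 : (0 < d `^ (- e^-1))%R by rewrite powR_gt0.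
have t0 : (0 < t)%R by exact: lt_le_trans td.
rewrite sub0r normrN ger0_norm ?powR_ge0// powRN.
rewrite invf_ple ?posrE ?powR_gt0//.
rewrite (_ : d^-1 = (d `^ (- e^-1)) `^ e)%R; last first.
  by rewrite -powRrM mulNr mulVf ?gt_eqF// powR_inv1// ltW.
by apply: ge0_ler_powR => //; rewrite ?nnegrE ?ltW.
Unshelve. all: by end_near. Qed.

Lemma integral_powRN (e T : R) : (0 < e)%R -> (0 < T)%R ->
  \int[mu]_(t in `[T, +oo[) (e * t `^ (- e - 1))%:E = (T `^ (- e))%:E.
Proof.
move=> e0 T0.
have pos t : (T <= t)%R -> (0 < t)%R by exact: lt_le_trans.
have dP (a t : R) : (0 < t)%R -> derivable (fun t : R => t `^ a)%R t 1.
  by move=> t0; apply: derivable_powR; rewrite in_itv/= t0.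
have cP (a t : R) : (0 < t)%R -> {for t, continuous (fun t : R => t `^ a)%R}.
  by move=> t0; apply/differentiable_continuous/derivable1_diffP/dP.
have := @ge0_continuous_FTC2y R (fun t => e * t `^ (- e - 1))%R
  (fun t => - t `^ (- e))%R T 0.
rewrite add0e -EFinN opprK; apply.
- by move=> t _; rewrite mulr_ge0 ?powR_ge0// ltW.
- apply: (@derivable_within_continuous _ _ _ `[T, +oo[) => t.
  rewrite in_itv/= andbT => /pos t0.
  by apply: derivableM => //; exact: dP.
- by rewrite -[X in _ --> X]oppr0; apply: cvgN; exact: powRN_cvgy.
- by move=> t /ltW/pos t0; apply: derivableN; exact: dP.
- by apply: cvgN; apply: cvg_at_right_filter; exact: cP.
- move=> t; rewrite in_itv/= andbT => /ltW/pos t0.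
  rewrite derive1E deriveN; last exact: dP.
  have [_ ->] := is_derive1_powR (- e) t0.
  by rewrite mulNr opprK.
Qed.

End line_integrals.

(** * Integrals of functions that need not be integrable *)

Section integral_total.
Context d (T : measurableType d) (R : realType).
Variable mu : {measure set T -> \bar R}.
Implicit Types (D : set T).

(** An integral is the difference of two nonnegative ones, and the convention
    [+oo - +oo = -oo] keeps that difference monotone. *)
Lemma ae_le_integral_total D (f g : T -> \bar R) : measurable D ->
  measurable_fun D f -> measurable_fun D g ->
  {ae mu, forall x, D x -> f x <= g x} ->
  \int[mu]_(x in D) f x <= \int[mu]_(x in D) g x.
Proof.
move=> mD mf mg fg; rewrite integralE [leRHS]integralE.
apply: leeB; apply: ae_ge0_le_integral => //.
- exact: measurable_funepos.
- exact: measurable_funepos.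
- apply: filterS fg => x fg Dx.
  by rewrite !funeposE ge_max !le_max fg//= lexx orbT.
- exact: measurable_funeneg.
- exact: measurable_funeneg.
- apply: filterS fg => x fg Dx.
  by rewrite !funenegE ge_max !le_max leeN2 fg//= lexx orbT.
Qed.

(** The positive (negative) part of [a + b] has an infinite integral exactly when
    that of [b] has, so the convention [+oo - +oo = -oo] gives the same value on both
    sides. *)
Lemma integralD_total D (a b : T -> R) : measurable D ->
  mu.-integrable D (EFin \o a) -> measurable_fun D b ->
  \int[mu]_(x in D) (a x + b x)%:E =
  \int[mu]_(x in D) (a x)%:E + \int[mu]_(x in D) (b x)%:E.
Proof.
move=> mD ia mb.
have ma : measurable_fun D a by apply/measurable_EFinP; exact: measurable_int ia.
have mab : measurable_fun D (fun x => a x + b x)%R by exact: measurable_funD.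
have fina : \int[mu]_(x in D) (a x)%:E \is a fin_num by exact: integrable_fin_num.
have finA : \int[mu]_(x in D) `|(a x)%:E| < +oo by have /integrableP[] := ia.
have mA : measurable_fun D (fun x => `|(a x)%:E|).
  by apply: measurableT_comp => //; exact/measurable_EFinP.
pose P (f : T -> R) := \int[mu]_(x in D) ((EFin \o f)^\+ x).
pose N (f : T -> R) := \int[mu]_(x in D) ((EFin \o f)^\- x).
have E (f : T -> R) : \int[mu]_(x in D) (f x)%:E = P f - N f by rewrite integralE.
have mP (f : T -> R) : measurable_fun D f -> measurable_fun D (EFin \o f)^\+.
  by move=> mf; apply: measurable_funepos; exact/measurable_EFinP.
have mN (f : T -> R) : measurable_fun D f -> measurable_fun D (EFin \o f)^\-.
  by move=> mf; apply: measurable_funeneg; exact/measurable_EFinP.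
have P0 (f : T -> R) : 0 <= P f by exact: integral_ge0.
have N0 (f : T -> R) : 0 <= N f by exact: integral_ge0.
(* Adding [a] changes the positive and negative parts by at most [|a|]. *)
have cmp (F G : T -> \bar R) : measurable_fun D F -> measurable_fun D G ->
    (forall x, 0 <= F x) -> (forall x, 0 <= G x) ->
    (forall x, F x <= G x + `|(a x)%:E|) -> \int[mu]_(x in D) F x = +oo ->
    \int[mu]_(x in D) G x = +oo.
  move=> mF mG F0 G0 FG Foo; apply/eqP; rewrite -leye_eq.
  have : +oo <= \int[mu]_(x in D) G x + \int[mu]_(x in D) `|(a x)%:E|.
    rewrite -Foo -ge0_integralD//; apply: ge0_le_integral => //.
    exact: emeasurable_funD.
  have : 0 <= \int[mu]_(x in D) G x by exact: integral_ge0.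
  case: (\int[mu]_(x in D) G x) => // r _.
  by move: finA; case: (\int[mu]_(x in D) `|(a x)%:E|).
have aux (f g : T -> R) x : (f x <= g x + `|a x|)%R ->
    (EFin \o f)^\+ x <= (EFin \o g)^\+ x + `|(a x)%:E|.
  move=> h; rewrite !funeposE/= -!EFin_max -EFinD lee_fin ge_max; apply/andP; split.
    by apply: le_trans h _; rewrite lerD2r le_max lexx.
  by rewrite addr_ge0// le_max lexx orbT.
have auxN (f g : T -> R) x : (g x <= f x + `|a x|)%R ->
    (EFin \o f)^\- x <= (EFin \o g)^\- x + `|(a x)%:E|.
  move=> h; rewrite !funenegE/= -!EFin_max -EFinD lee_fin ge_max.
  apply/andP; split; last by rewrite addr_ge0// le_max lexx orbT.
  apply: (@le_trans _ _ (- g x + `|a x|)%R); first by lra.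
  by rewrite lerD2r le_max lexx.
have leab x : (a x <= `|a x|)%R /\ (- a x <= `|a x|)%R.
  by split; rewrite ?ler_norm// -normrN ler_norm.
rewrite (E b); have [Noo|Nfin] := eqVneq (N b) +oo.
  rewrite Noo/= (E (fun x => a x + b x)%R).
  suff -> : N (fun x => a x + b x)%R = +oo by rewrite /= !addeNy.
  apply: (cmp _ _ (mN b mb) (mN _ mab) _ _ _ Noo) => //.
  by move=> x; apply: auxN; have [? ?] := leab x; lra.
have [Poo|Pfin] := eqVneq (P b) +oo.
  rewrite Poo addye ?eqe_oppLR// addey -?ltNye ?ltNye_eq ?fina//.
  rewrite (E (fun x => a x + b x)%R).
  have -> : P (fun x => a x + b x)%R = +oo.
    apply: (cmp _ _ (mP b mb) (mP _ mab) _ _ _ Poo) => //.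
    by move=> x; apply: aux; have [? ?] := leab x; lra.
  rewrite addye// eqe_oppLR/=; apply/eqP => h; move/eqP: Nfin; apply.
  apply: (cmp _ _ (mN _ mab) (mN b mb) _ _ _ h) => //.
  by move=> x; apply: auxN; have [? ?] := leab x; lra.
rewrite -(E b).
have ib : mu.-integrable D (EFin \o b).
  apply/integrableP; split; first exact/measurable_EFinP.
  rewrite (_ : (fun x => _) = abse \o (EFin \o b))// fune_abse.
  rewrite ge0_integralD//; [|exact: mP|exact: mN].
  by rewrite lte_add_pinfty// ltey.
by rewrite -integralD//; apply: eq_integral => x _; rewrite EFinD.
Qed.

End integral_total.

(** * Radial integration *)

Section layer_cake.
Context {R : realType} {n : nat}.
Notation lam := (@lebesgue_measure R).
Notation mu := (lebesgue_n R n).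

(** The radial coordinate whose distribution is Lebesgue measure on the
    half-line; the weights below are powers of it. *)
Definition radvol (x : Rn R n) : R := vball n (enorm x).

Lemma measurable_radvol : measurable_fun setT radvol.
Proof.
rewrite (_ : radvol = (fun x => enorm x ^+ n.+1 * vball n 1)%R); last first.
  by apply/funext => x; rewrite /radvol vballE// enorm_ge0.
apply: measurable_funM; last exact: measurable_cst.
by apply: measurable_funX; exact: measurable_enorm.
Qed.

Lemma radvol_ge0 x : (0 <= radvol x)%R. Proof. exact: vball_ge0. Qed.

Lemma eball_radvol (r : R) y : (0 <= r)%R -> eball r y = (radvol y < vball n r)%R.
Proof. by move=> r0; rewrite /radvol ltr_vball ?enorm_ge0. Qed.

Lemma measurable_radvol_lt (a : R) : measurable [set y | (radvol y < a)%R].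
Proof.
rewrite -[X in measurable X]setTI (_ : [set x | _] = radvol @^-1` `]-oo, a[).
  exact: measurable_radvol.
by apply/seteqP; split => x /=; rewrite in_itv.
Qed.

Lemma lebesgue_radvol_lt (a : R) :
  mu [set x | (radvol x < a)%R] = (Num.max a 0)%:E.
Proof.
have [a0|a0] := leP a 0%R.
  rewrite (_ : [set _ | _] = set0) ?measure0//.
  by apply/seteqP; split => // x /= /lt_le_trans -/(_ _ a0); rewrite ltNge radvol_ge0.
have [r r0 <-] := @vball_surj R n _ a0.
rewrite -lebesgue_eballE; congr (mu _).
by apply/seteqP; split => x; rewrite /radvol/eball/= ltr_vball// ?enorm_ge0// ltW.
Qed.

Lemma measurable_radvol0 : measurable [set x | (radvol x = 0)%R].
Proof.
rewrite -[X in measurable X]setTI (_ : [set x | _] = radvol @^-1` [set 0%R])//.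
by apply: measurable_radvol.
Qed.

Lemma lebesgue_radvol0 : mu [set x | (radvol x = 0)%R] = 0.
Proof.
apply/eqP; rewrite eq_le measure_ge0 andbT; apply/lee_addgt0Pr => e e0.
rewrite add0e (_ : e%:E = mu [set x | (radvol x < e)%R]); last first.
  by rewrite lebesgue_radvol_lt max_l// ltW.
apply: le_measure; rewrite ?inE; [exact: measurable_radvol0| |by move=> x /= ->].
exact: measurable_radvol_lt.
Qed.

Lemma radvol_gt0_ae : {ae mu, forall x, (0 < radvol x)%R}.
Proof.
exists [set x | (radvol x = 0)%R]; split => //.
- exact: measurable_radvol0.
- exact: lebesgue_radvol0.
- move=> x /= h; apply/eqP; rewrite eq_le radvol_ge0 andbT leNgt.
  exact/negP.
Qed.

(** Tonelli's theorem on [Rn * R]: for a fixed [t] the set [{y | radvol y < t}]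
    has measure [max t 0].  A function is given by its values almost everywhere
    because the formula for [G] can fail at the origin. *)
Lemma layer_cake (phi : R -> R) (G : Rn R n -> \bar R) :
  measurable_fun setT phi -> (forall t, 0 <= phi t)%R ->
  measurable_fun setT G ->
  {ae mu, forall y, G y = \int[lam]_t (phi t * (radvol y < t)%R%:R)%:E} ->
  \int[mu]_y G y = \int[lam]_t (phi t * Num.max t 0)%:E.
Proof.
move=> mphi phi0 mG GE.
pose f (z : Rn R n * R) := (phi z.2 * (radvol z.1 < z.2)%R%:R)%:E.
have mf : measurable_fun setT f.
  apply/measurable_EFinP; apply: measurable_funM.
    by apply: (measurableT_comp mphi).
  have mb : measurable_fun setT (fun z : Rn R n * R => (radvol z.1 < z.2)%R).
    apply: measurable_fun_ltr => //.
    by apply: (measurableT_comp measurable_radvol).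
  exact: (measurableT_comp (f := fun b : bool => (b%:R : R))).
have f0 z : 0 <= f z by rewrite lee_fin mulr_ge0.
transitivity (\int[mu]_y fubini_F lam f y).
  apply: ae_eq_integral; [exact: measurableT|exact: mG| |].
    exact: measurable_fun_fubini_tonelli_F.
  by apply: filterS GE => y ->.
transitivity (\int[lam]_t fubini_G mu f t).
  exact: (@fubini_tonelli _ _ _ _ _ mu lam f mf f0).
apply: eq_integral => t _; rewrite /fubini_G/f/=.
have mt := measurable_radvol_lt t.
rewrite (eq_integral (fun y => (phi t)%:E * (\1_[set y | radvol y < t]%R y)%:E)).
  rewrite ge0_integralZl; [|by []| | |by rewrite lee_fin]; last 2 first.
  - by apply/measurable_EFinP; exact: measurable_indic.
  - by move=> y _; rewrite lee_fin indicE.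
  rewrite integral_indic// setIT EFinM; congr (_ * _); exact: lebesgue_radvol_lt.
move=> y _; rewrite -EFinM indicE; congr ((_ * (nat_of_bool _)%:R)%:E).
by apply/idP/idP; rewrite inE.
Qed.

Lemma measurable_ln_radvol D : measurable_fun D (fun y : Rn R n => ln (radvol y)).
Proof.
apply: measurable_funTS; apply: (measurableT_comp (@measurable_ln R)).
exact: measurable_radvol.
Qed.

(** [ln X - ln (radvol y)] is the integral of [1/t] between [radvol y] and [X]. *)
Lemma integral_ln_radvol_ratio (r : R) : (0 < r)%R ->
  mu.-integrable (eball r)
    (fun y => (ln (vball n r) - ln (radvol y))%:E) /\
  \int[mu]_(y in eball r) (ln (vball n r) - ln (radvol y))%:E = (vball n r)%:E.
Proof.
move=> r0; set X := vball n r.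
have X0 : (0 < X)%R by rewrite vball_gt0.
pose phi (t : R) := (\1_`]0%R, X] t * t `^ (-1))%R.
have mphi : measurable_fun setT phi.
  by apply: measurable_funM; [exact: measurable_indic|exact: measurable_powR].
have phi0 t : (0 <= phi t)%R by rewrite mulr_ge0 ?indicE ?powR_ge0.
pose g (y : Rn R n) := (ln X - ln (radvol y))%:E.
have mg : measurable_fun (eball r) g.
  apply/measurable_EFinP/measurable_funB; first exact: measurable_cst.
  exact: measurable_ln_radvol.
have inX y : eball r y = (radvol y < X)%R by exact: eball_radvol (ltW r0).
have innerE : {ae mu, forall y, (g \_ (eball r)) y =
    \int[lam]_t (phi t * (radvol y < t)%R%:R)%:E}.
  apply: filterS radvol_gt0_ae => y y0; rewrite patchE.
  case: ifPn => yr.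
    have yX : (radvol y < X)%R by rewrite -inX; apply: set_mem.
    rewrite /g -(integral_inv y0 yX) -integral_itv_obnd_cbnd; last first.
      apply: (eq_measurable_fun (fun t : R => (t `^ (-1))%:E)).
        move=> t; rewrite inE/= in_itv/= => /andP[/ltW yt _].
        by rewrite powR_inv1// (le_trans (ltW y0)).
      by apply: measurable_funTS; apply/measurable_EFinP; exact: measurable_powR.
    rewrite integral_mkcond; apply: eq_integral => t _.
    rewrite patchE mem_setE in_itv/= /phi indicE mem_setE in_itv/=.
    have [yt|ty] := ltP (radvol y) t; last by rewrite mulr0.
    rewrite (lt_trans y0 yt)/= mulr1.
    case: (t <= X)%R; last by rewrite mul0r.
    by rewrite mul1r powR_inv1// ltW// (lt_trans y0).
  rewrite integral0_eq// => t _; rewrite /phi indicE mem_setE in_itv/=.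
  have Xy : (X <= radvol y)%R.
    by rewrite leNgt; apply/negP; rewrite -inX => /mem_set; rewrite (negbTE yr).
  have [yt|ty] := ltP (radvol y) t; last by rewrite mulr0.
  by rewrite [(t <= X)%R]leNgt (le_lt_trans Xy yt) andbF !mul0r.
have phiX : \int[lam]_t (phi t * Num.max t 0)%:E = X%:E.
  transitivity (\int[lam]_(t in `]0%R, X]) (cst 1 t)).
    rewrite [RHS]integral_mkcond; apply: eq_integral => t _.
    rewrite patchE /phi indicE mem_setE in_itv/=.
    have [t0|t0] /= := ltP 0%R t; last by rewrite !mul0r.
    case: (t <= X)%R; last by rewrite !mul0r.
    by rewrite mul1r powR_inv1 ?(ltW t0)// mulVf ?gt_eqF.
  by rewrite integral_cst//= lebesgue_measure_itv/= lte_fin X0 sube0 mul1e.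
have mgr : measurable_fun setT (g \_ (eball r)).
  by apply/(measurable_restrictT _ _).1; [exact: measurable_eball|exact: mg].
split; last by rewrite integral_mkcond (layer_cake mphi phi0 mgr innerE).
apply/integrableP; split; first exact: mg.
rewrite integral_mkcond (_ : _ \_ _ = abse \o (g \_ (eball r))); last first.
  by apply/funext => y; rewrite /= !patchE; case: ifPn => // _; rewrite abse0.
have absE : {ae mu, forall y, (abse \o (g \_ (eball r))) y =
    \int[lam]_t (phi t * (radvol y < t)%R%:R)%:E}.
  apply: filterS innerE => y gE.
  rewrite -gE/= gee0_abs// gE; apply: integral_ge0 => t _.
  by rewrite lee_fin mulr_ge0.
have mabs : measurable_fun setT (abse \o (g \_ (eball r))).
  by apply: measurableT_comp; [exact: abse_measurable|exact: mgr].
by rewrite (layer_cake mphi phi0 mabs absE) phiX ltry.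
Qed.

End layer_cake.
Lemma powR_div (R : realType) (a b s : R) : (0 <= a)%R -> (0 <= b)%R ->
  ((a / b) `^ s = a `^ s * b `^ (- s))%R.
Proof.
move=> a0 b0; rewrite powRM ?invr_ge0//; congr (_ * _)%R.
by rewrite -(powR_inv1 b0) -powRrM mulN1r.
Qed.

Section radial_integrals.
Context {R : realType} {n : nat}.
Notation lam := (@lebesgue_measure R).
Notation mu := (lebesgue_n R n).
Notation radvol := (@radvol R n).

Lemma integrable_cst_eball (r c : R) : mu.-integrable (eball r) (cst c%:E).
Proof.
apply/integrableP; split; first exact: measurable_cst.
rewrite (_ : (fun _ => _) = cst `|c|%:E)// integral_cst; last exact: measurable_eball.
by rewrite [X in _ * X](lebesgue_eballE r) -EFinM ltry.
Qed.

Lemma integral_ln_radvol (r a b : R) : (0 < r)%R ->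
  mu.-integrable (eball r) (fun y => (a + b * ln (radvol y))%:E) /\
  \int[mu]_(y in eball r) (a + b * ln (radvol y))%:E =
    (vball n r * (a + b * (ln (vball n r) - 1)))%:E.
Proof.
move=> r0; have [ig Ig] := @integral_ln_radvol_ratio R n r r0.
set X := vball n r in ig Ig *.
pose g (y : Rn R n) := (ln X - ln (radvol y))%:E.
have E : (fun y => (a + b * ln (radvol y))%:E) =
    (fun y => (a + b * ln X)%:E + (- b)%:E * g y).
  by apply/funext => y; rewrite /g -EFinM -EFinD; congr (_%:E); ring.
have mb : measurable (@eball R n r) by exact: measurable_eball.
have ibg : mu.-integrable (eball r) (fun y => (- b)%:E * g y).
  by apply: integrableZl.
have ic := integrable_cst_eball r (a + b * ln X)%R.
rewrite E; split; first by apply: integrableD.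
rewrite (integralD mb ic ibg) (integral_cst _ mb) (integralZl mb ig) [X in _ + _ * X]Ig.
rewrite [X in _ * X + _](lebesgue_eballE r).
by rewrite -!EFinM -EFinD; congr (_%:E); rewrite -/X; ring.
Qed.

(** The integrand is the integral of [s T^s t^(-s-1)] over the [t >= T] above
    [radvol y]. *)
Lemma integral_radvol_powN (s T : R) : (1 < s)%R -> (0 < T)%R ->
  \int[mu]_y ((T / Num.max (radvol y) T) `^ s)%:E = (T * (s / (s - 1)))%:E.
Proof.
move=> s1 T0.
have s0 : (0 < s)%R by exact: lt_trans s1.
pose phi (t : R) := (\1_`[T, +oo[ t * (T `^ s * (s * t `^ (- s - 1))))%R.
have mphi : measurable_fun setT phi.
  apply: measurable_funM; first exact: measurable_indic.
  apply: measurable_funM; first exact: measurable_cst.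
  apply: measurable_funM; first exact: measurable_cst.
  exact: measurable_powR.
have phi0 t : (0 <= phi t)%R.
  by rewrite !mulr_ge0 ?indicE ?powR_ge0// ltW.
pose g (y : Rn R n) := ((T / Num.max (radvol y) T) `^ s)%:E.
have mg : measurable_fun setT g.
  apply/measurable_EFinP.
  rewrite (_ : (fun _ => _) =
    (fun y : Rn R n => T `^ s * Num.max (radvol y) T `^ (- s))%R); last first.
    apply/funext => y; have m0 : (0 <= Num.max (radvol y) T)%R.
      by rewrite le_max radvol_ge0.
    by rewrite powR_div// ltW.
  apply: measurable_funM; first exact: measurable_cst.
  apply: (measurableT_comp (measurable_powR _)).
  apply: measurable_maxr; [exact: measurable_radvol|exact: measurable_cst].
have mp (D : set R) (a c : R) : measurable_fun D (fun t : R => (c * t `^ a)%:E).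
  apply: measurable_funTS; apply/measurable_EFinP.
  apply: measurable_funM; first exact: measurable_cst.
  exact: measurable_powR.
have powE (b : R) : (0 < b)%R ->
    \int[lam]_(t in `[b, +oo[) (T `^ s * (s * t `^ (- s - 1)))%:E =
    ((T / b) `^ s)%:E.
  move=> b0; under eq_integral do rewrite EFinM.
  rewrite ge0_integralZl//; last 3 first.
  - exact: mp.
  - by move=> t _; rewrite lee_fin mulr_ge0 ?powR_ge0// ltW.
  - by rewrite lee_fin powR_ge0.
  by rewrite integral_powRN// -EFinM powR_div ?(ltW T0) ?(ltW b0).
have innerE y : g y = \int[lam]_t (phi t * (radvol y < t)%R%:R)%:E.
  rewrite /g; have [yT|Ty] := ltP (radvol y) T.
    rewrite -(powE T T0) integral_mkcond; apply: eq_integral => t _.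
    rewrite patchE /phi indicE !mem_setE !in_itv/= !andbT.
    have [Tt|] := leP T t; last by rewrite !mul0r.
    by rewrite (lt_le_trans yT Tt) mul1r mulr1.
  have y0 : (0 < radvol y)%R by exact: lt_le_trans Ty.
  rewrite -(powE _ y0) -integral_itv_obnd_cbnd; last first.
    rewrite (_ : (fun _ => _) = (fun t : R => (T `^ s * s * t `^ (- s - 1))%:E)).
      exact: mp.
    by apply/funext => t; rewrite mulrA.
  rewrite integral_mkcond; apply: eq_integral => t _.
  rewrite patchE /phi indicE !mem_setE !in_itv/= !andbT.
  have [yt|ty] := ltP (radvol y) t; last by rewrite mulr0.
  by rewrite (le_trans Ty (ltW yt)) mul1r mulr1.
rewrite (layer_cake mphi phi0 mg) -/g; last exact: aeW.
have e0 : (0 < s - 1)%R by rewrite subr_gt0.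
transitivity (\int[lam]_(t in `[T, +oo[)
   ((T `^ s * (s / (s - 1)))%:E * ((s - 1) * t `^ (- (s - 1) - 1))%:E)).
  rewrite [RHS]integral_mkcond; apply: eq_integral => t _.
  rewrite patchE /phi indicE mem_setE in_itv/= andbT.
  have [Tt|] := leP T t; last by rewrite !mul0r.
  have t0 : (0 < t)%R by exact: lt_le_trans Tt.
  rewrite max_l ?(ltW t0)// -EFinM; congr (_%:E).
  rewrite (_ : - (s - 1) - 1 = - s - 1 + 1)%R; last by ring.
  rewrite (@powRD _ t (- s - 1) 1) ?(gt_eqF t0) ?implybT// powRr1 ?(ltW t0)//.
  by rewrite mul1r; field; rewrite gt_eqF.
rewrite ge0_integralZl//; last 3 first.
- exact: mp.
- by move=> t _; rewrite lee_fin mulr_ge0 ?powR_ge0// ltW.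
- by rewrite lee_fin mulr_ge0 ?powR_ge0 ?divr_ge0 ?(ltW s0) ?(ltW e0).
rewrite integral_powRN// -EFinM; congr (_%:E).
have TE : (T = T `^ s * T `^ (- (s - 1)))%R.
  by rewrite -powRD ?(gt_eqF T0) ?implybT// opprB addrC subrK powRr1 // ltW.
by rewrite [in RHS]TE; ring.
Qed.

End radial_integrals.
(** * The extremal density *)

Section extremal_density.
Context {R : realType} {n : nat}.
Notation mu := (lebesgue_n R n).
Notation radvol := (@radvol R n).
Variables (s T : R).
Hypotheses (s1 : (1 < s)%R) (T0 : (0 < T)%R).

(** Constant up to the radial volume [T] and [e^-s T^(s-1) radvol^-s] beyond.
    The jump by [e^-s] at [T] is what makes its geometric mean over larger balls
    an exact power of the radial volume. *)
Definition extremal (y : Rn R n) : R :=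
  (T^-1 * (\1_[set x | radvol x < T] y * (1 - expR (- s)) +
           expR (- s) * (T / Num.max (radvol y) T) `^ s))%R.

Lemma extremalE y : extremal y =
  (if radvol y < T then T^-1 else T^-1 * (expR (- s) * (T / radvol y) `^ s))%R.
Proof.
rewrite /extremal indicE; case: ifPn => h.
  rewrite mem_set// mul1r max_r ?(ltW h)// divff ?gt_eqF// powR1.
  by rewrite mulr1 subrK mulr1.
by rewrite memNset; [rewrite mul0r add0r max_l// leNgt|move/negP: h].
Qed.

Lemma extremal_gt0 y : (0 < extremal y)%R.
Proof.
rewrite extremalE; case: (ltP (radvol y) T) => h; first by rewrite invr_gt0.
by rewrite !mulr_gt0 ?invr_gt0 ?expR_gt0 ?powR_gt0 ?divr_gt0// (lt_le_trans T0).
Qed.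

Lemma measurable_tail : measurable_fun setT
  (fun y => (T / Num.max (radvol y) T) `^ s)%R.
Proof.
rewrite (_ : (fun _ => _) =
  (fun y : Rn R n => T `^ s * Num.max (radvol y) T `^ (- s))%R); last first.
  apply/funext => y; rewrite powR_div// ?(ltW T0)//.
  by rewrite le_max radvol_ge0.
apply: measurable_funM; first exact: measurable_cst.
apply: (measurableT_comp (measurable_powR _)).
apply: measurable_maxr; [exact: measurable_radvol|exact: measurable_cst].
Qed.

Lemma measurable_extremal : measurable_fun setT extremal.
Proof.
apply: measurable_funM; first exact: measurable_cst.
apply: measurable_funD.
  apply: measurable_funM; last exact: measurable_cst.
  by apply: measurable_indic; exact: measurable_radvol_lt.
by apply: measurable_funM; [exact: measurable_cst|exact: measurable_tail].
Qed.

Lemma integral_extremal :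
  \int[mu]_y (extremal y)%:E = (1 + expR (- s) / (s - 1))%:E.
Proof.
have s0 : (0 < s - 1)%R by rewrite subr_gt0.
have es : (0 <= 1 - expR (- s))%R.
  by rewrite subr_ge0 -expR0 ler_expR oppr_le0 ltW// (lt_trans _ s1).
pose a (y : Rn R n) := (\1_[set x | radvol x < T]%R y)%:E : \bar R.
pose b (y : Rn R n) := ((T / Num.max (radvol y) T) `^ s)%:E : \bar R.
have ma : measurable_fun setT a.
  by apply/measurable_EFinP/measurable_indic; exact: measurable_radvol_lt.
have mb : measurable_fun setT b by apply/measurable_EFinP; exact: measurable_tail.
have a0 y : 0 <= a y by rewrite lee_fin indicE.
have b0 y : 0 <= b y by rewrite lee_fin powR_ge0.
have c1 : (0 <= T^-1 * (1 - expR (- s)))%R by rewrite mulr_ge0// invr_ge0 ltW.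
have c2 : (0 <= T^-1 * expR (- s))%R.
  by rewrite mulr_ge0 ?expR_ge0// invr_ge0 ltW.
rewrite (_ : (fun y => (extremal y)%:E) = (fun y =>
   (T^-1 * (1 - expR (- s)))%:E * a y + (T^-1 * expR (- s))%:E * b y)); last first.
  apply/funext => y; rewrite /a /b /extremal -!EFinM -EFinD.
  by congr (_%:E); ring.
rewrite ge0_integralD; [|exact: measurableT| | | |]; last 4 first.
- by move=> y _; rewrite mule_ge0.
- exact: measurable_funeM.
- by move=> y _; rewrite mule_ge0.
- exact: measurable_funeM.
have Z (c : R) (f : Rn R n -> \bar R) : (0 <= c)%R -> measurable_fun setT f ->
    (forall y, 0 <= f y) -> \int[mu]_y (c%:E * f y) = c%:E * \int[mu]_y f y.
  by move=> c0 mf f0; rewrite ge0_integralZl.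
rewrite (Z _ _ c1 ma a0) (Z _ _ c2 mb b0).
have -> : \int[mu]_y a y = T%:E.
  rewrite integral_indic; [|exact: measurableT|exact: measurable_radvol_lt].
  by rewrite setIT [LHS](lebesgue_radvol_lt T) max_l ?ltW.
rewrite [X in _ + _ * X](@integral_radvol_powN R n s T s1 T0).
rewrite -!EFinM -EFinD; congr (_%:E).
by field; rewrite !gt_eqF.
Qed.

Lemma integral_ln_extremal (t r : R) : (0 < t)%R -> (t < r)%R -> T = vball n t ->
  mu.-integrable (eball r) (fun y => (ln (extremal y))%:E) /\
  \int[mu]_(y in eball r) (ln (extremal y))%:E =
    (vball n r * ((s - 1) * ln T - s * ln (vball n r)))%:E.
Proof.
move=> t0 tr TE; have r0 : (0 < r)%R by exact: lt_trans tr.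
have [ia Ia] := @integral_ln_radvol R n r ((s - 1) * ln T - s) (- s) r0.
have [ib Ib] := @integral_ln_radvol R n t (s - s * ln T) s t0.
have mt : measurable (@eball R n t) by exact: measurable_eball.
have mr : measurable (@eball R n r) by exact: measurable_eball.
pose a (y : Rn R n) := ((s - 1) * ln T - s + - s * ln (radvol y))%:E : \bar R.
pose b := (fun y : Rn R n => (s - s * ln T + s * ln (radvol y))%:E : \bar R)
  \_ (eball t).
have lnE y : (ln (extremal y))%:E = a y + b y.
  rewrite extremalE /a /b patchE; case: (ltP (radvol y) T) => h.
    rewrite mem_set; last by rewrite eball_radvol ?(ltW t0)// -TE.
    by rewrite lnV ?posrE// -EFinD; congr (_%:E); ring.
  rewrite memNset; last first.
    by rewrite eball_radvol ?(ltW t0)// -TE; apply/negP; rewrite -leNgt.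
  have y0 : (0 < radvol y)%R by exact: lt_le_trans h.
  rewrite adde0 !lnM ?posrE ?mulr_gt0 ?invr_gt0 ?expR_gt0 ?powR_gt0 ?divr_gt0//.
  rewrite ln_powR ln_div ?posrE// lnV ?posrE// expRK.
  by congr (_%:E); ring.
have tsr : eball t `<=` @eball R n r by move=> y /= /lt_trans; apply.
have ibr : mu.-integrable (eball r) b.
  by apply/integrable_restrict => //; rewrite setIidr.
rewrite (_ : (fun y => (ln (extremal y))%:E) = (fun y => a y + b y)); last first.
  exact/funext.
split; first exact: integrableD.
rewrite (integralD mr ia ibr) [X in X + _]Ia.
(* The contributions of [V < T] cancel: [e^-s] was chosen for this. *)
rewrite (_ : \int[mu]_(y in eball r) b y = 0) ?adde0; last first.
  rewrite -integral_mkcondr setIidr// [LHS]Ib -TE.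
  by congr (_%:E); ring.
by congr (_%:E); ring.
Qed.

End extremal_density.
(** * Measurability of geometric means *)

Section measurability.
Context d (T : measurableType d) (R : realType).

Lemma measurable_fun_powR (f q : T -> R) :
  measurable_fun setT f -> measurable_fun setT q ->
  measurable_fun setT (fun x => f x `^ q x)%R.
Proof.
move=> mf mq; rewrite /powR.
apply: measurable_fun_ifT.
- by apply: measurable_fun_eqr => //; exact: measurable_cst.
- apply: (measurableT_comp (f := fun b : bool => (b%:R : R))) => //.
  by apply: measurable_fun_eqr => //; exact: measurable_cst.
- apply: (measurableT_comp (@measurable_expR R)).
  by apply: measurable_funM => //; exact: (measurableT_comp (@measurable_ln R)).
Qed.

Lemma measurable_fun_poweR (f : T -> \bar R) (q : T -> R) :
  measurable_fun setT f -> measurable_fun setT q ->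
  measurable_fun setT (fun x => f x `^ q x).
Proof.
move=> mf mq.
have mfine : measurable_fun setT (fine \o f) by exact: measurableT_comp.
have meqe (c : \bar R) : measurable_fun setT (fun x => f x == c).
  by apply: measurable_fun_eqe => //; exact: measurable_cst.
have mq0 : measurable_fun setT (fun x => q x == 0%R).
  by apply: measurable_fun_eqr => //; exact: measurable_cst.
have mp : measurable_fun setT (fun x => (fine (f x) `^ q x)%:E).
  by apply/measurable_EFinP; exact: measurable_fun_powR.
rewrite (_ : (fun _ => _) = (fun x =>
    if f x == +oo then (if q x == 0%R then 1 else +oo) else
    if f x == -oo then (if q x == 0%R then 1 else 0) else
    (fine (f x) `^ q x)%:E)); last first.
  by apply/funext => x; case: (f x).
apply: measurable_fun_ifT => //.
  by apply: measurable_fun_ifT => //; exact: measurable_cst.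
apply: measurable_fun_ifT => //.
by apply: measurable_fun_ifT => //; exact: measurable_cst.
Qed.

Lemma measurable_fun_expeR (f : T -> \bar R) : measurable_fun setT f ->
  measurable_fun setT (fun x => expeR (f x)).
Proof.
move=> mf.
rewrite (_ : (fun _ => _) = (fun x => if f x == +oo then +oo else
  if f x == -oo then 0 else (expR (fine (f x)))%:E)); last first.
  by apply/funext => x; case: (f x).
have meqe (c : \bar R) : measurable_fun setT (fun x => f x == c).
  by apply: measurable_fun_eqe => //; exact: measurable_cst.
apply: measurable_fun_ifT => //; apply: measurable_fun_ifT => //.
apply/measurable_EFinP; apply: (measurableT_comp (@measurable_expR R)).
exact: measurableT_comp.
Qed.

Lemma measurable_fun_inv_ge0 (f : T -> R) : measurable_fun setT f ->
  (forall x, 0 <= f x)%R -> measurable_fun setT (fun x => (f x)^-1)%R.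
Proof.
move=> mf f0; rewrite (_ : (fun _ => _) = (fun x => f x `^ (-1))%R); last first.
  by apply/funext => x; rewrite powR_inv1.
exact: (measurableT_comp (measurable_powR _)).
Qed.

End measurability.

Section geometric_mean.
Context {R : realType} {n : nat}.
Notation mu := (lebesgue_n R n).
Notation radvol := (@radvol R n).
Implicit Types (f g : Rn R n -> R) (x y : Rn R n).

Lemma measurable_enorm_lt :
  measurable_fun setT (fun z : Rn R n * Rn R n => (enorm z.2 < enorm z.1)%R).
Proof.
apply: measurable_fun_ltr; apply: (measurableT_comp (@measurable_enorm R n)).
  exact: measurable_snd.
exact: measurable_fst.
Qed.

Lemma measurable_integral_eball (g : Rn R n -> \bar R) : measurable_fun setT g ->
  measurable_fun setT (fun x => \int[mu]_(y in eball (enorm x)) g y).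
Proof.
have pos (h : Rn R n -> \bar R) : measurable_fun setT h -> (forall y, 0 <= h y) ->
    measurable_fun setT (fun x => \int[mu]_(y in eball (enorm x)) h y).
  move=> mh h0.
  pose F (z : Rn R n * Rn R n) := if (enorm z.2 < enorm z.1)%R then h z.2 else 0.
  have mF : measurable_fun setT F.
    apply: measurable_fun_ifT; first exact: measurable_enorm_lt.
      by apply: (measurableT_comp mh); exact: measurable_snd.
    exact: measurable_cst.
  have F0 z : 0 <= F z by rewrite /F; case: ifP.
  have := measurable_fun_fubini_tonelli_F (m2 := mu) F mF F0.
  congr (measurable_fun _ _); apply/funext => x.
  rewrite [RHS]integral_mkcond; apply: eq_integral => y _.
  rewrite /F patchE /=; case: ifPn => xy; first by rewrite mem_set.
  by rewrite memNset//; apply/negP.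
move=> mg.
rewrite (_ : (fun _ => _) = (fun x => \int[mu]_(y in eball (enorm x)) g^\+ y -
    \int[mu]_(y in eball (enorm x)) g^\- y)); last first.
  by apply/funext => x; rewrite integralE.
apply: emeasurable_funB; apply: pos => //.
  exact: measurable_funepos.
exact: measurable_funeneg.
Qed.

Lemma measurable_geomean g : measurable_fun setT g ->
  measurable_fun setT (geomean g).
Proof.
move=> mg; apply: measurable_fun_expeR; apply: emeasurable_funM.
  apply/measurable_EFinP/measurable_fun_inv_ge0; first exact: measurable_radvol.
  exact: radvol_ge0.
apply: measurable_integral_eball; apply/measurable_EFinP.
exact: (measurableT_comp (@measurable_ln R)).
Qed.

Lemma geomean_ge0 g x : 0 <= geomean g x. Proof. exact: expeR_ge0. Qed.

(** Splitting the logarithm off an integrable part [a] multiplies the geometric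
    mean, even when the remaining factor has mean [0] or [+oo]. *)
Lemma expeR_average_split x (a b : Rn R n -> R) (A : R) :
  mu.-integrable (eball (enorm x)) (EFin \o a) ->
  measurable_fun setT b ->
  \int[mu]_(y in eball (enorm x)) (a y)%:E = A%:E ->
  expeR ((radvol x)^-1%:E * \int[mu]_(y in eball (enorm x)) (a y + b y)%:E) =
  (expR ((radvol x)^-1 * A))%:E *
    expeR ((radvol x)^-1%:E * \int[mu]_(y in eball (enorm x)) (b y)%:E).
Proof.
move=> ia mb IA; rewrite integralD_total//.
- by rewrite IA muleDr// ?expeRD// fin_num_adde_defr.
- exact: measurable_eball.
- exact: measurable_funTS.
Qed.

End geometric_mean.
(** * Convexity inequalities *)

Section jensen.
Context {R : realType}.

(** Convexity of [a |-> a^r], with the tangent line at [c]. *)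
Lemma young_tangent (a c r : R) : (0 <= a)%R -> (0 <= c)%R -> (1 <= r)%R ->
  (r * c `^ (r - 1) * a <= a `^ r + (r - 1) * c `^ r)%R.
Proof.
move=> a0 c0; rewrite le_eqVlt => /predU1P[<-|r1].
  by rewrite subrr powRr0 !mul1r mul0r addr0 powRr1.
have r0 : (0 < r)%R by exact: lt_trans r1.
have rm : (0 < r - 1)%R by rewrite subr_gt0.
have rN0 : r != 0%R by rewrite gt_eqF.
have rmN0 : (r - 1 != 0)%R by rewrite gt_eqF.
have := @conjugate_powR R a (c `^ (r - 1))%R r (r / (r - 1))%R a0 (powR_ge0 _ _) r0
  (divr_gt0 r0 rm) _.
rewrite (_ : (r^-1 + (r / (r - 1))^-1)%R = 1%R); last by rewrite invf_div; field.
move=> /(_ erefl) H.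
have E : ((c `^ (r - 1)) `^ (r / (r - 1)) = c `^ r)%R.
  by rewrite -powRrM; congr (_ `^ _)%R; field.
rewrite E in H.
rewrite -(ler_pM2l r0) in H.
apply: le_trans (_ : (r * (a * c `^ (r - 1)) <= _)%R).
  by rewrite le_eqVlt; apply/orP; left; apply/eqP; ring.
apply: le_trans H _; rewrite le_eqVlt; apply/orP; left; apply/eqP.
rewrite invf_div; field; exact: rN0.
Qed.

(** Jensen's inequality for a density [h] of mass at most 1: the defect of mass
    only helps, since the tangent of [a |-> a^r] at [c] is nonpositive at [0]. *)
Lemma le_integral_powR d (T : measurableType d) (mu : {measure set T -> \bar R})
    (D : set T) (h a : T -> R) (r c : R) : measurable D ->
  measurable_fun D h -> measurable_fun D a ->
  (forall y, 0 <= h y)%R -> (forall y, 0 <= a y)%R -> (1 <= r)%R -> (0 <= c)%R ->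
  \int[mu]_(y in D) (h y)%:E <= 1 ->
  \int[mu]_(y in D) (h y * a y)%:E = c%:E ->
  (c `^ r)%:E <= \int[mu]_(y in D) (h y * a y `^ r)%:E.
Proof.
move=> mD mh ma h0 a0 r1 c0 h1 hc.
have r0 : (0 <= r)%R by exact: le_trans r1.
have rm : (0 <= r - 1)%R by rewrite subr_ge0.
have cr0 : (0 <= c `^ r)%R by exact: powR_ge0.
have mha : measurable_fun D (fun y => (h y * a y)%:E).
  by apply/measurable_EFinP; exact: measurable_funM.
have mhr : measurable_fun D (fun y => (h y * a y `^ r)%:E).
  apply/measurable_EFinP; apply: measurable_funM => //.
  by apply: (measurableT_comp (measurable_powR _)).
have mhE : measurable_fun D (fun y => (h y)%:E) by exact/measurable_EFinP.
have H : \int[mu]_(y in D) ((r * c `^ (r - 1))%:E * (h y * a y)%:E) <=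
    \int[mu]_(y in D) ((h y * a y `^ r)%:E + ((r - 1) * c `^ r)%:E * (h y)%:E).
  apply: ge0_le_integral => //.
  - by move=> y _; rewrite mule_ge0// lee_fin mulr_ge0 ?powR_ge0.
  - exact: measurable_funeM.
  - by apply: emeasurable_funD => //; exact: measurable_funeM.
  - move=> y _; rewrite -!EFinM -EFinD lee_fin.
    have := ler_wpM2l (h0 y) (young_tangent (a0 y) c0 r1).
    by rewrite mulrDr; lra.
have hr0 y : 0 <= (h y * a y `^ r)%:E by rewrite lee_fin mulr_ge0 ?powR_ge0.
have Z (k : R) (f : T -> \bar R) : (0 <= k)%R -> measurable_fun D f ->
    (forall y, 0 <= f y) ->
    \int[mu]_(y in D) (k%:E * f y) = k%:E * \int[mu]_(y in D) f y.
  by move=> k0 mf f0; rewrite ge0_integralZl.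
rewrite ge0_integralD in H; [|by []|by []|by []| |exact: measurable_funeM]; last first.
  by move=> y _; rewrite -EFinM lee_fin !mulr_ge0.
rewrite Z ?mulr_ge0 ?powR_ge0// in H; last by move=> y; rewrite lee_fin mulr_ge0.
rewrite Z ?mulr_ge0 ?powR_ge0// in H.
move: H; rewrite hc -EFinM => H.
have E : (r * c `^ (r - 1) * c = r * c `^ r)%R.
  have [->|cN0] := eqVneq c 0%R.
    by rewrite mulr0 powR0 ?mulr0// gt_eqF// (lt_le_trans _ r1).
  rewrite -mulrA; congr (_ * _)%R; rewrite -[X in (_ * X)%R]powRr1// -powRD ?subrK//.
  by rewrite cN0 implybT.
rewrite E in H.
have H2 : ((r - 1) * c `^ r)%:E * \int[mu]_(y in D) (h y)%:E <=
    ((r - 1) * c `^ r)%:E * 1.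
  by apply: lee_wpmul2l => //; rewrite lee_fin mulr_ge0.
have := le_trans H (leeD2l _ H2).
rewrite mule1 -leeBlDr// -EFinB; apply: le_trans.
by rewrite lee_fin; lra.
Qed.

End jensen.
(** * Bounding the geometric mean *)

Section geomean_upper_bound.
Context {R : realType} {n : nat}.
Notation mu := (lebesgue_n R n).
Notation radvol := (@radvol R n).
Implicit Types (x y : Rn R n).

(** Concavity of the logarithm, in the form of its tangent line at the mean, is
    applied to the density multiplied by [radvol^(s-1)]; the geometric mean of
    that power is [e^-(s-1) radvol^(s-1)]. *)
Lemma geomean_le (s p lambda c : R) (f v : Rn R n -> R) x :
  (0 < p)%R -> (0 < lambda)%R -> (0 < c)%R -> (0 < radvol x)%R ->
  measurable_fun setT f -> measurable_fun setT v -> (forall y, 0 < f y)%R ->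
  (forall y, 0 <= v y)%R -> {ae mu, forall y, (0 < v y)%R} ->
  \int[mu]_(y in eball (enorm x))
    (`|f y * v y * lambda^-1| `^ p * radvol y `^ (s - 1))%:E = c%:E ->
  geomean f x <=
    (lambda * (expR (s - 1) * radvol x `^ (- s) * c) `^ (1 / p))%:E *
    geomean (fun y => 1 / v y)%R x.
Proof.
move=> p0 l0 c0 X0 mf mv f0 v_ge0 v0 hc.
have r0 : (0 < enorm x)%R by move: X0; rewrite vball_gt0.
set X := radvol x in X0 *.
pose h y := (`|f y * v y * lambda^-1| `^ p)%R.
pose hV y := (h y * radvol y `^ (s - 1))%R.
have mh : measurable_fun setT h.
  apply: (measurableT_comp (measurable_powR p)).
  apply: measurableT_comp; first exact: normr_measurable.
  by apply: measurable_funM; [exact: measurable_funM|exact: measurable_cst].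
have mhV : measurable_fun setT hV.
  apply: measurable_funM; first exact: mh.
  by apply: (measurableT_comp (measurable_powR _)); exact: measurable_radvol.
have hV0 y : (0 <= hV y)%R by rewrite mulr_ge0 ?powR_ge0.
have mB : measurable (@eball R n (enorm x)) by exact: measurable_eball.
have ihV : mu.-integrable (eball (enorm x)) (EFin \o hV).
  apply/integrableP; split; first by apply: measurable_funTS; exact/measurable_EFinP.
  under eq_integral do rewrite /= ger0_norm//.
  by rewrite hc ltry.
pose k := (ln lambda + p^-1 * (ln (c / X) - 1))%R.
pose a1 y := (p^-1 * (X / c) * hV y)%R.
pose a2 y := (k + - (p^-1 * (s - 1)) * ln (radvol y))%R.
have [ia2 Ia2] := @integral_ln_radvol R n (enorm x) k (- (p^-1 * (s - 1)))%R r0.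
have ia1 : mu.-integrable (eball (enorm x)) (EFin \o a1).
  rewrite (_ : _ \o _ = (fun y => (p^-1 * (X / c))%:E * (EFin \o hV) y)).
    exact: integrableZl.
  by apply/funext.
have Ia1 : \int[mu]_(y in eball (enorm x)) (a1 y)%:E = (p^-1 * X)%:E.
  rewrite (_ : (fun y => (a1 y)%:E) =
    (fun y => (p^-1 * (X / c))%:E * (EFin \o hV) y)); last exact/funext.
  rewrite integralZl// [X in _ * X]hc -EFinM; congr (_%:E).
  by field; rewrite !gt_eqF.
pose a y := (a1 y + a2 y)%R.
have ia : mu.-integrable (eball (enorm x)) (EFin \o a).
  rewrite (_ : _ \o _ = (EFin \o a1) \+ (EFin \o a2)); first exact: integrableD.
  by apply/funext.
have Ia : \int[mu]_(y in eball (enorm x)) (a y)%:E =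
    (p^-1 * X + X * (k - p^-1 * (s - 1) * (ln X - 1)))%:E.
  rewrite (_ : (fun y => (a y)%:E) = (fun y => (a1 y)%:E + (a2 y)%:E)); last first.
    by apply/funext.
  rewrite (integralD mB ia1 ia2) [X in X + _]Ia1 [X in _ + X]Ia2.
  by rewrite -EFinD -[vball n (enorm x)]/X; congr (_%:E); ring.
have mb : measurable_fun setT (fun y => ln (1 / v y))%R.
  apply: (measurableT_comp (@measurable_ln R)); apply: measurable_funM.
    exact: measurable_cst.
  exact: measurable_fun_inv_ge0.
have ma : measurable_fun (eball (enorm x)) a.
  by apply/measurable_EFinP; exact: measurable_int ia.
have le_int : \int[mu]_(y in eball (enorm x)) (ln (f y))%:E <=
    \int[mu]_(y in eball (enorm x)) (a y + ln (1 / v y)%R)%:E.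
  apply: ae_le_integral_total; first exact: mB.
  - apply: measurable_funTS; apply/measurable_EFinP.
    exact: (measurableT_comp (@measurable_ln R)).
  - apply/measurable_EFinP; apply: measurable_funD; first exact: ma.
    exact: measurable_funTS.
  - apply: filterS2 v0 (@radvol_gt0_ae R n) => y vy Vy _; rewrite lee_fin.
    have g0 : (0 < f y * v y * lambda^-1)%R by rewrite !mulr_gt0// invr_gt0.
    have h0 : (0 < h y)%R by rewrite powR_gt0// normr_gt0 gt_eqF.
    have z0 : (0 < hV y)%R by rewrite mulr_gt0// powR_gt0.
    have lnhV : (ln (hV y) = p * (ln (f y) + ln (v y) - ln lambda) +
        (s - 1) * ln (radvol y))%R.
      rewrite /hV /h lnM ?posrE ?powR_gt0 ?normr_gt0 ?gt_eqF// !ln_powR gtr0_norm//.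
      by rewrite !lnM ?posrE ?mulr_gt0 ?invr_gt0// lnV ?posrE.
    have : (ln (hV y * (X / c)) <= hV y * (X / c) - 1)%R.
      rewrite -[X in (ln X <= _)%R](subrK 1%R) addrC.
      by apply: le_ln1Dx; rewrite ltrBDl subrr mulr_gt0// divr_gt0.
    rewrite lnM ?posrE// ?divr_gt0// ln_div ?posrE//.
    rewrite lnhV => H.
    rewrite mul1r lnV ?posrE// /a /a1 /a2 /k ln_div ?posrE//.
    rewrite -(ler_pM2l p0).
    apply: le_trans (_ : (hV y * (X / c) - 1 - (s - 1) * ln (radvol y)
       + (ln c - ln X) + p * ln lambda - p * ln (v y) <= _)%R).
      by lra.
    rewrite le_eqVlt; apply/orP; left; apply/eqP.
    by field; rewrite !gt_eqF.
rewrite /geomean -[vball n (enorm x)]/X.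
apply: le_trans (_ : expeR ((X^-1)%:E *
    \int[mu]_(y in eball (enorm x)) (a y + ln (1 / v y)%R)%:E) <= _).
  by rewrite lee_expeR; apply: lee_wpmul2l => //; rewrite lee_fin invr_ge0 ltW.
rewrite (expeR_average_split ia mb Ia) -/X.
apply: lee_wpmul2r; first exact: expeR_ge0.
rewrite lee_fin le_eqVlt; apply/orP; left; apply/eqP.
have Q0 : (0 < (expR (s - 1) * X `^ (- s) * c) `^ (1 / p))%R.
  by rewrite powR_gt0// !mulr_gt0 ?expR_gt0 ?powR_gt0.
rewrite -[RHS]lnK ?posrE ?mulr_gt0//; congr expR.
rewrite lnM ?posrE// ln_powR !lnM ?posrE ?mulr_gt0 ?expR_gt0 ?powR_gt0//.
rewrite expRK ln_powR /k ln_div ?posrE//.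
by field; rewrite !gt_eqF.
Qed.

Lemma integral_eball_gt0 (r : R) (g : Rn R n -> R) : (0 < r)%R ->
  measurable_fun setT g -> (forall y, 0 <= g y)%R ->
  {ae mu, forall y, (0 < g y)%R} ->
  0 < \int[mu]_(y in eball r) (g y)%:E.
Proof.
move=> r0 mg g0 gpos; rewrite lt_neqAle integral_ge0 ?andbT; last first.
  by move=> y _; rewrite lee_fin.
apply/eqP => /esym I0.
have mB : measurable (@eball R n r) by exact: measurable_eball.
have mgB : measurable_fun (eball r) (EFin \o g).
  by apply: measurable_funTS; exact/measurable_EFinP.
have Iabs : \int[mu]_(y in eball r) `|(EFin \o g) y| = 0.
  by rewrite -[RHS]I0; apply: eq_integral => y _; rewrite /= ger0_norm.
have aeN : {ae mu, forall y, ~ eball r y}.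
  have := (ae_eq_integral_abs mu mB mgB).1 Iabs.
  apply: filterS2 gpos => y gy gE yr; move: gy.
  by have /= [->] := gE yr; rewrite ltxx.
have [N [mN N0 subN]] := aeN.
suff : lebesgue_n R n (eball r) <= 0.
  by rewrite lebesgue_eballE lee_fin leNgt vball_gt0 r0.
rewrite -[leRHS]N0; apply: le_measure; rewrite ?inE// => y yr.
by apply: subN => /= /(_ yr).
Qed.

End geomean_upper_bound.

(** * Modulars *)

Section vnorm.
Context {R : realType} {n : nat}.
Notation mu := (lebesgue_n R n).
Implicit Types (Omega : set (Rn R n)) (q omega : Rn R n -> R).

Lemma le_poweR (a b : \bar R) (r : R) : (0 <= r)%R -> 0 <= a -> a <= b ->
  a `^ r <= b `^ r.
Proof.
move=> r0 a0 ab; apply: gt0_ler_poweR => //; rewrite in_itv/= ?a0 ?leey//.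
by rewrite andbT (le_trans a0 ab).
Qed.

Lemma vnorm_ge0 Omega q omega F : 0 <= vnorm Omega q omega F.
Proof.
by apply: le_ereal_inf_tmp => _ [l [l0 _] <-]; rewrite lee_fin ltW.
Qed.

Lemma measurable_modular Omega q omega F (l : R) : measurable_fun setT q ->
  measurable_fun setT omega -> measurable_fun setT F ->
  measurable_fun Omega
    (fun x : Rn R n => `|F x * (omega x)%:E * (l^-1)%:E| `^ q x).
Proof.
move=> mq mo mF; apply: measurable_funTS; apply: measurable_fun_poweR; last exact: mq.
apply: measurableT_comp; first exact: abse_measurable.
apply: emeasurable_funM; last exact: measurable_cst.
by apply: emeasurable_funM; [exact: mF|exact/measurable_EFinP].
Qed.

(** The modular decreases in the parameter, so that every number above the norm
    is admissible in the infimum defining it. *)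
Lemma vnorm_lt_modular Omega q omega F (l : R) : measurable Omega ->
  measurable_fun setT q -> measurable_fun setT omega -> measurable_fun setT F ->
  {ae mu, forall x, (0 <= q x)%R} -> vnorm Omega q omega F < l%:E ->
  \int[mu]_(x in Omega) (`|F x * (omega x)%:E * (l^-1)%:E| `^ q x) <= 1.
Proof.
move=> mO mq mo mF q0 /ereal_inf_lt[_ [l' [l'0 H] <-]]; rewrite lte_fin => l'l.
have l0 : (0 < l)%R by exact: lt_trans l'l.
apply: le_trans H; apply: ae_ge0_le_integral; first exact: mO.
- by move=> x _; exact: poweR_ge0.
- exact: measurable_modular.
- by move=> x _; exact: poweR_ge0.
- exact: measurable_modular.
- apply: filterS q0 => x q0 _; apply: le_poweR => //.
  rewrite !abseM; apply: lee_wpmul2l => //.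
  have [i i'] : (0 <= l^-1 /\ 0 <= l'^-1)%R by rewrite !invr_ge0 !ltW.
  by rewrite !gee0_abs ?lee_fin// lef_pV2 ?posrE// ltW.
Qed.

End vnorm.
(** * Finiteness of the constant is sufficient *)

Section sufficiency.
Context {R : realType} {n : nat}.
Notation mu := (lebesgue_n R n).
Notation radvol := (@radvol R n).
Implicit Types (x y : Rn R n).

Definition Dweight (s p : R) (v w : Rn R n -> R) x : \bar R :=
  (w x / radvol x `^ (s / p))%:E * geomean (fun y => 1 / v y)%R x.

Lemma measurable_Dweight (s p : R) (v w : Rn R n -> R) : measurable_fun setT v -> measurable_fun setT w ->
  (forall y, 0 <= v y)%R -> measurable_fun setT (Dweight s p v w).
Proof.
move=> mv mw v0; apply: emeasurable_funM.
  apply/measurable_EFinP; apply: measurable_funM; first exact: mw.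
  apply: measurable_fun_inv_ge0; last by move=> x; exact: powR_ge0.
  by apply: (measurableT_comp (measurable_powR _)); exact: measurable_radvol.
apply: measurable_geomean; apply: measurable_funM; first exact: measurable_cst.
exact: measurable_fun_inv_ge0.
Qed.

Lemma Dweight_ge0 (s p : R) (v w : Rn R n -> R) x : (forall y, 0 <= w y)%R -> 0 <= Dweight s p v w x.
Proof.
by move=> w0; rewrite mule_ge0 ?geomean_ge0// lee_fin divr_ge0 ?powR_ge0.
Qed.

Lemma Dconst_ge0 (s p : R) (q v w : Rn R n -> R) : 0 <= @Dconst R n s p q v w.
Proof.
apply: le_trans (_ : (vball n 1 `^ ((s - 1) / p))%:E * vnorm [set x | (1 < enorm x)%R]
  q (cst 1%R) (Dweight s p v w) <= _).
  by rewrite mule_ge0 ?vnorm_ge0// lee_fin powR_ge0.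
by apply: ereal_sup_ubound; exists 1%R => //=.
Qed.

Variables (p s : R) (q v w : Rn R n -> R).
Hypotheses (p0 : (0 < p)%R) (s1 : (1 < s)%R) (mq : measurable_fun setT q)
  (pq : {ae mu, forall x, (p <= q x)%R}).
Hypotheses (mv : measurable_fun setT v) (v_ge0 : forall x, (0 <= v x)%R)
  (v_gt0 : {ae mu, forall x, (0 < v x)%R}).
Hypotheses (mw : measurable_fun setT w) (w_ge0 : forall x, (0 <= w x)%R).
Notation k := (Dweight s p v w).
Notation alpha := ((s - 1) / p)%R.

Let alpha_gt0 : (0 < alpha)%R.
Proof. by rewrite divr_gt0// subr_gt0. Qed.

Let mk : measurable_fun setT k. Proof. exact: measurable_Dweight. Qed.

(** The integrand of the modular in the definition of [Dconst] at the radius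
    [enorm y], for the parameter [D / radvol y ^ alpha]; as a kernel in [x] and
    [y] it is what Tonelli's theorem is applied to. *)
Definition modular_density (D : R) x y : \bar R :=
  `|k x * (cst 1%R x)%:E * ((D / radvol y `^ alpha)^-1)%:E| `^ q x.

Lemma modular_densityE D x y : (0 < D)%R -> modular_density D x y =
  ((radvol y `^ alpha)%:E * (k x * (D^-1)%:E)) `^ q x.
Proof.
move=> D0; rewrite /modular_density mule1 invf_div EFinM gee0_abs; last first.
  apply: mule_ge0; first exact: Dweight_ge0.
  by apply: mule_ge0; rewrite lee_fin ?powR_ge0// invr_ge0 ltW.
by rewrite muleCA.
Qed.

Lemma modular_density_le1 (D : R) y : Dconst s p q v w < D%:E ->
  (0 < radvol y)%R ->
  \int[mu]_(x in [set x | (enorm y < enorm x)%R]) modular_density D x y <= 1.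
Proof.
move=> hD y0; apply: vnorm_lt_modular.
- exact: measurable_gt_enorm.
- exact: mq.
- exact: measurable_cst.
- exact: mk.
- by apply: filterS pq => x; exact: le_trans (ltW p0).
- rewrite mulrC EFinM -lte_pdivrMl ?invr_gt0 ?powR_gt0// invrK.
  apply: le_lt_trans hD; apply: ereal_sup_ubound; exists (enorm y) => //=.
  by move: y0; rewrite vball_gt0.
Qed.

Variables (f : Rn R n -> R) (l : R).
Hypotheses (mf : measurable_fun setT f) (f_gt0 : forall x, (0 < f x)%R)
  (l_gt0 : (0 < l)%R).

Let h y : R := (`|f y * v y * l^-1| `^ p)%R.

Hypothesis h_le1 : \int[mu]_y (h y)%:E <= 1.

Let mh : measurable_fun setT h.
Proof.
apply: (measurableT_comp (measurable_powR p)).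
apply: measurableT_comp; first exact: normr_measurable.
by apply: measurable_funM; [exact: measurable_funM|exact: measurable_cst].
Qed.

Let h_ge0 y : (0 <= h y)%R. Proof. exact: powR_ge0. Qed.

Let mV (a : R) : measurable_fun setT (fun y => radvol y `^ a)%R.
Proof.
by apply: (measurableT_comp (measurable_powR _)); exact: measurable_radvol.
Qed.

(** Both convexity inequalities, with the power [q x / p] moved under the
    integral over [y]. *)
Lemma modular_pointwise (D : R) x : (0 < D)%R -> (p <= q x)%R -> (0 < radvol x)%R ->
  `|geomean f x * (w x)%:E * ((expR alpha * D * l)^-1)%:E| `^ q x <=
  \int[mu]_(y in eball (enorm x)) ((h y)%:E * modular_density D x y).
Proof.
move=> D0 pqx X0.
have r0 : (0 < enorm x)%R by move: X0; rewrite vball_gt0.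
have mB : measurable (@eball R n (enorm x)) by exact: measurable_eball.
have q0 : (0 < q x)%R by exact: lt_le_trans pqx.
pose kD := k x * (D^-1)%:E.
have kD0 : 0 <= kD by rewrite mule_ge0 ?Dweight_ge0// lee_fin invr_ge0 ltW.
have hB : \int[mu]_(y in eball (enorm x)) (h y)%:E <= 1.
  apply: le_trans h_le1; apply: ge0_subset_integral; [exact: mB|exact: measurableT| | |].
  - exact/measurable_EFinP.
  - by move=> y _; rewrite lee_fin.
  - exact: subsetT.
have mhV : measurable_fun setT (fun y => h y * radvol y `^ (s - 1))%R.
  by apply: measurable_funM; [exact: mh|exact: mV].
have I_gt0 : 0 < \int[mu]_(y in eball (enorm x)) (h y * radvol y `^ (s - 1))%:E.
  apply: integral_eball_gt0 => //.
    by move=> y; rewrite mulr_ge0 ?powR_ge0.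
  apply: filterS2 v_gt0 (@radvol_gt0_ae R n) => y vy Vy.
  by rewrite mulr_gt0 ?powR_gt0// normr_gt0 gt_eqF// !mulr_gt0// invr_gt0.
have I_lty : \int[mu]_(y in eball (enorm x)) (h y * radvol y `^ (s - 1))%:E < +oo.
  apply: (@le_lt_trans _ _ ((radvol x `^ (s - 1))%:E * 1)); last by rewrite mule1 ltry.
  apply: (@le_trans _ _ (\int[mu]_(y in eball (enorm x))
      ((radvol x `^ (s - 1))%:E * (h y)%:E))).
    apply: ge0_le_integral; first exact: mB.
    - by move=> y _; rewrite lee_fin mulr_ge0 ?powR_ge0.
    - by apply: measurable_funTS; exact/measurable_EFinP.
    - by apply: measurable_funTS; apply: measurable_funeM; exact/measurable_EFinP.
    - move=> y; rewrite eball_radvol ?(ltW r0)// => yx.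
      have Vle : (radvol y `^ (s - 1) <= radvol x `^ (s - 1))%R.
        apply: ge0_ler_powR; rewrite ?nnegrE ?radvol_ge0 ?subr_ge0 ?(ltW s1)//.
        exact: ltW.
      by rewrite -EFinM lee_fin [leRHS]mulrC; exact: ler_wpM2l.
  rewrite ge0_integralZl.
  - by apply: lee_wpmul2l => //; rewrite lee_fin powR_ge0.
  - exact: mB.
  - by apply: measurable_funTS; exact/measurable_EFinP.
  - by move=> y _; rewrite lee_fin.
  - by rewrite lee_fin powR_ge0.
have [c cE] : exists c : R,
    \int[mu]_(y in eball (enorm x)) (h y * radvol y `^ (s - 1))%:E = c%:E.
  exists (fine (\int[mu]_(y in eball (enorm x)) (h y * radvol y `^ (s - 1))%:E)).
  by rewrite fineK// ge0_fin_numE// ltW.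
rewrite cE lte_fin in I_gt0.
have c1 : (0 <= c `^ (1 / p))%R by exact: powR_ge0.
apply: (@le_trans _ _ (((c `^ (1 / p))%:E * kD) `^ q x)).
  apply: le_poweR; [exact: ltW|exact: abse_ge0|].
  have C0 : (0 <= (expR alpha * D * l)^-1)%R.
    by rewrite invr_ge0 !mulr_ge0 ?expR_ge0// ltW.
  rewrite gee0_abs ?mule_ge0 ?geomean_ge0 ?lee_fin//.
  have := geomean_le p0 l_gt0 I_gt0 X0 mf mv f_gt0 v_ge0 v_gt0 cE.
  set A := (l * _)%R; move: (geomean_ge0 (fun y => 1 / v y)%R x) => G0 GA.
  apply: (@le_trans _ _ (A%:E * geomean (fun y => 1 / v y)%R x * (w x)%:E *
      ((expR alpha * D * l)^-1)%:E)).
    by apply: lee_wpmul2r; [rewrite lee_fin|apply: lee_wpmul2r; rewrite ?lee_fin].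
  rewrite /kD /Dweight.
  have -> : A%:E * geomean (fun y => 1 / v y)%R x * (w x)%:E *
      ((expR alpha * D * l)^-1)%:E =
      (A * w x * (expR alpha * D * l)^-1)%:E * geomean (fun y => 1 / v y)%R x.
    rewrite (muleAC A%:E _ (w x)%:E) (muleAC _ _ ((expR alpha * D * l)^-1)%:E).
    by rewrite -!EFinM.
  have -> : (c `^ (1 / p))%:E * ((w x / radvol x `^ (s / p))%:E *
      geomean (fun y => 1 / v y)%R x * (D^-1)%:E) =
      (c `^ (1 / p) * (w x / radvol x `^ (s / p)) * D^-1)%:E *
        geomean (fun y => 1 / v y)%R x.
    by rewrite muleAC muleA -!EFinM mulrA.
  rewrite le_eqVlt; apply/orP; left; apply/eqP; congr (_%:E * _).
  rewrite /A !powRM ?mulr_ge0 ?expR_ge0 ?powR_ge0 ?(ltW I_gt0)//.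
  rewrite -powRrM (_ : - s * (1 / p) = - (s / p))%R; last by field; rewrite gt_eqF.
  rewrite powRN.
  have -> : (expR (s - 1) `^ (1 / p) = expR alpha)%R.
    by rewrite /powR gt_eqF ?expR_gt0// expRK; congr expR; field; rewrite gt_eqF.
  by field; rewrite !gt_eqF ?expR_gt0 ?powR_gt0.
pose r := (q x / p)%R.
have r1 : (1 <= r)%R by rewrite ler_pdivlMr// mul1r.
have dE y : (h y)%:E * modular_density D x y =
    kD `^ q x * (h y * (radvol y `^ (s - 1)) `^ r)%:E.
  rewrite modular_densityE// poweRM ?lee_fin ?powR_ge0// poweR_EFin -powRrM.
  rewrite (_ : alpha * q x = (s - 1) * r)%R; last by rewrite /r; field; rewrite gt_eqF.
  by rewrite powRrM -/kD EFinM; rewrite muleA muleC.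
under eq_integral do rewrite dE.
rewrite ge0_integralZl; last 4 first.
- exact: mB.
- apply: measurable_funTS; apply/measurable_EFinP; apply: measurable_funM.
    exact: mh.
  by apply: (measurableT_comp (measurable_powR _)); exact: mV.
- by move=> y _; rewrite lee_fin mulr_ge0 ?powR_ge0.
- exact: poweR_ge0.
rewrite poweRM ?lee_fin// muleC; apply: lee_wpmul2l; first exact: poweR_ge0.
rewrite poweR_EFin -powRrM (_ : 1 / p * q x = r)%R; last by rewrite /r mulrC mulrA mulr1.
apply: le_integral_powR.
- exact: mB.
- exact: measurable_funTS.
- by apply: measurable_funTS; exact: mV.
- exact: h_ge0.
- by move=> y; exact: powR_ge0.
- exact: r1.
- exact: ltW.
- exact: hB.
- exact: cE.
Qed.

(** After exchanging the integrals, the inner one is a modular over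
    [enorm y < enorm x] and the outer one is the integral of [h]. *)
Lemma geomean_modular_le1 (D : R) : Dconst s p q v w < D%:E ->
  \int[mu]_x (`|geomean f x * (w x)%:E * ((expR alpha * D * l)^-1)%:E| `^ q x) <= 1.
Proof.
move=> hD; have D0 : (0 < D)%R.
  by rewrite -lte_fin; apply: le_lt_trans hD; exact: Dconst_ge0.
pose F (z : Rn R n * Rn R n) :=
  if (enorm z.2 < enorm z.1)%R then (h z.2)%:E * modular_density D z.1 z.2 else 0.
have F0 z : 0 <= F z.
  by rewrite /F; case: ifP => // _; rewrite mule_ge0 ?lee_fin ?poweR_ge0.
have mF : measurable_fun setT F.
  apply: measurable_fun_ifT; [exact: measurable_enorm_lt| |exact: measurable_cst].
  apply: emeasurable_funM.
    apply/measurable_EFinP; apply: (measurableT_comp mh); exact: measurable_snd.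
  rewrite (_ : (fun _ => _) = (fun z : Rn R n * Rn R n =>
      ((radvol z.2 `^ alpha)%:E * (k z.1 * (D^-1)%:E)) `^ q z.1)); last first.
    by apply/funext => z; rewrite modular_densityE.
  apply: measurable_fun_poweR.
    apply: emeasurable_funM.
      apply/measurable_EFinP; apply: (measurableT_comp (mV alpha)).
      exact: measurable_snd.
    apply: emeasurable_funM; last exact: measurable_cst.
    by apply: (measurableT_comp mk); exact: measurable_fst.
  by apply: (measurableT_comp mq); exact: measurable_fst.
have FE x : fubini_F mu F x =
    \int[mu]_(y in eball (enorm x)) ((h y)%:E * modular_density D x y).
  rewrite [RHS]integral_mkcond; apply: eq_integral => y _.
  rewrite /F patchE /=; case: ifPn => xy; first by rewrite mem_set.
  by rewrite memNset//; apply/negP.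
have GE y : fubini_G mu F y =
    \int[mu]_(x in [set x | (enorm y < enorm x)%R])
      ((h y)%:E * modular_density D x y).
  rewrite [RHS]integral_mkcond; apply: eq_integral => x _.
  rewrite /F patchE /=; case: ifPn => xy; first by rewrite mem_set.
  by rewrite memNset//; apply/negP.
apply: (@le_trans _ _ (\int[mu]_x fubini_F mu F x)).
  apply: ae_ge0_le_integral.
  - exact: measurableT.
  - by move=> x _; exact: poweR_ge0.
  - apply: measurable_modular; [exact: mq|exact: mw|].
    exact: measurable_geomean.
  - by move=> x _; apply: integral_ge0 => y _; exact: F0.
  - exact: measurable_fun_fubini_tonelli_F.
  - apply: filterS2 pq (@radvol_gt0_ae R n) => x pqx X0 _.
    by rewrite FE; exact: modular_pointwise.
have -> : \int[mu]_x fubini_F mu F x = \int[mu]_y fubini_G mu F y.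
  exact: (@fubini_tonelli _ _ _ _ _ mu mu F mF F0).
apply: le_trans h_le1; apply: ae_ge0_le_integral.
- exact: measurableT.
- by move=> y _; apply: integral_ge0 => x _; exact: F0.
- exact: measurable_fun_fubini_tonelli_G.
- by move=> y _; rewrite lee_fin.
- exact/measurable_EFinP.
- apply: filterS (@radvol_gt0_ae R n) => y Y0 _; rewrite GE ge0_integralZl.
  + rewrite -[leRHS]mule1; apply: lee_wpmul2l; first by rewrite lee_fin.
    exact: modular_density_le1.
  + exact: measurable_gt_enorm.
  + by apply: measurable_modular; [exact: mq|exact: measurable_cst|exact: mk].
  + by move=> x _; exact: poweR_ge0.
  + by rewrite lee_fin.
Qed.

End sufficiency.

Lemma Dconst_geomean_ineq (R : realType) (n : nat) (p s D : R)
    (q v w : Rn R n -> R) : (0 < p)%R -> (1 < s)%R -> measurable_fun setT q ->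
  {ae lebesgue_n R n, forall x, (p <= q x)%R} ->
  weight setT v -> weight setT w -> Dconst s p q v w < D%:E ->
  geomean_ineq p q v w (expR ((s - 1) / p) * D)%R.
Proof.
move=> p0 s1 mq pq [mv v0 v1] [mw w0 _] hD f mf f0.
have D0 : (0 < D)%R.
  by rewrite -lte_fin; apply: le_lt_trans hD; exact: Dconst_ge0.
have C0 : (0 < expR ((s - 1) / p) * D)%R by rewrite mulr_gt0 ?expR_gt0.
rewrite -lee_pdivrMl//; apply: le_ereal_inf_tmp => _ [l [l0 hl] <-].
rewrite lee_pdivrMl// -EFinM; apply: ereal_inf_lbound.
exists (expR ((s - 1) / p) * D * l)%R => //; split; first by rewrite mulr_gt0.
apply: (geomean_modular_le1 p0 s1 mq pq mv _ _ mw _ mf f0 l0 _ hD).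
- by move=> x; exact: v0.
- by apply: filterS v1 => x; apply.
- by move=> x; exact: w0.
- exact: hl.
Qed.

(** * Finiteness of the constant is necessary *)

Lemma expR_ln_powR (R : realType) (X T p s : R) :
  (0 < X)%R -> (0 < T)%R -> (0 < p)%R ->
  (expR (X^-1 * (p^-1 * (X * ((s - 1) * ln T - s * ln X)))) =
   T `^ ((s - 1) / p) * X `^ (- (s / p)))%R.
Proof.
move=> X0 T0 p0; rewrite /powR !gt_eqF// -expRD; congr expR.
by field; rewrite !gt_eqF.
Qed.

Section necessity.
Context {R : realType} {n : nat}.
Notation mu := (lebesgue_n R n).
Notation radvol := (@radvol R n).
Implicit Types (x y : Rn R n).
Variables (p s : R) (q v w : Rn R n -> R).
Hypotheses (p0 : (0 < p)%R) (s1 : (1 < s)%R) (mq : measurable_fun setT q).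
Hypotheses (mv : measurable_fun setT v) (v_ge0 : forall x, (0 <= v x)%R)
  (v_gt0 : {ae mu, forall x, (0 < v x)%R}).
Hypotheses (mw : measurable_fun setT w).

(** The branch [v y <= 0] only keeps the function positive on a null set. *)
Definition test_fun (T : R) y : R :=
  (if 0 < v y then extremal s T y `^ (1 / p) / v y else extremal s T y `^ (1 / p))%R.

Lemma test_fun_gt0 T y : (0 < T)%R -> (0 < test_fun T y)%R.
Proof.
move=> T0; have e0 : (0 < extremal s T y `^ (1 / p))%R.
  by rewrite powR_gt0// extremal_gt0.
by rewrite /test_fun; case: ifP => // vy; rewrite divr_gt0.
Qed.

Lemma measurable_test_fun T : (0 < T)%R -> measurable_fun setT (test_fun T).
Proof.
move=> T0.
have me : measurable_fun setT (fun y => extremal s T y `^ (1 / p))%R.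
  by apply: (measurableT_comp (measurable_powR _)); exact: measurable_extremal.
apply: measurable_fun_ifT; last exact: me.
  by apply: measurable_fun_ltr; [exact: measurable_cst|exact: mv].
by apply: measurable_funM; [exact: me|exact: measurable_fun_inv_ge0].
Qed.

Let mass : R := (1 + expR (- s) / (s - 1))%R.

Let mass_gt0 : (0 < mass)%R.
Proof. by rewrite addr_gt0// divr_gt0 ?expR_gt0// subr_gt0. Qed.

Lemma vnorm_test_fun T : (0 < T)%R ->
  vnorm setT (cst p) v (fun y => (test_fun T y)%:E) <= (mass `^ (1 / p))%:E.
Proof.
move=> T0; have M0 : (0 < mass `^ (1 / p))%R by rewrite powR_gt0.
apply: ereal_inf_lbound; exists (mass `^ (1 / p))%R => //; split => //.
rewrite (_ : 1 = \int[mu]_y ((mass^-1)%:E * (extremal s T y)%:E)); last first.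
  rewrite ge0_integralZl.
  - by rewrite integral_extremal// -EFinM mulVf// gt_eqF.
  - exact: measurableT.
  - by apply/measurable_EFinP; exact: measurable_extremal.
  - by move=> y _; rewrite lee_fin ltW// extremal_gt0.
  - by rewrite lee_fin invr_ge0 ltW.
apply: ae_ge0_le_integral.
- exact: measurableT.
- by move=> y _; exact: poweR_ge0.
- apply: measurable_modular; [exact: measurable_cst|exact: mv|].
  by apply/measurable_EFinP; exact: measurable_test_fun.
- by move=> y _; rewrite -EFinM lee_fin mulr_ge0 ?invr_ge0 ?(ltW mass_gt0)// ltW// extremal_gt0.
- by apply: measurable_funeM; apply/measurable_EFinP; exact: measurable_extremal.
- apply: filterS v_gt0 => y vy _; rewrite /test_fun vy.
  have e0 := extremal_gt0 s T0 y.
  have e1 : (0 <= extremal s T y `^ (1 / p))%R by exact: powR_ge0.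
  rewrite -!EFinM /= divfK ?gt_eqF// ger0_norm ?divr_ge0 ?e1 ?(ltW M0)// lee_fin.
  rewrite powR_div// ?(ltW M0)// powRN -!powRrM mul1r mulVf ?gt_eqF//.
  by rewrite !powRr1 ?(ltW e0) ?(ltW mass_gt0)// mulrC.
Qed.

Lemma geomean_test_fun (t : R) x : (0 < t)%R -> (t < enorm x)%R ->
  geomean (test_fun (vball n t)) x =
  (vball n t `^ ((s - 1) / p) * radvol x `^ (- (s / p)))%:E *
    geomean (fun y => 1 / v y)%R x.
Proof.
move=> t0 tx; set T := vball n t.
have T0 : (0 < T)%R by rewrite vball_gt0.
have x0 : (0 < enorm x)%R by exact: lt_trans tx.
have X0 : (0 < radvol x)%R by rewrite vball_gt0.
have [ie Ie] := @integral_ln_extremal R n s T T0 t (enorm x) t0 tx erefl.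
have mB : measurable (@eball R n (enorm x)) by exact: measurable_eball.
pose a y := (p^-1 * ln (extremal s T y))%R.
have aE : EFin \o a = (fun y => (p^-1)%:E * (ln (extremal s T y))%:E).
  exact/funext.
have ia : mu.-integrable (eball (enorm x)) (EFin \o a).
  by rewrite aE; exact: integrableZl.
have Ia : \int[mu]_(y in eball (enorm x)) (a y)%:E =
    (p^-1 * (radvol x * ((s - 1) * ln T - s * ln (radvol x))))%:E.
  rewrite (_ : (fun y => (a y)%:E) = EFin \o a)// aE (integralZl mB ie).
  by rewrite [X in _ * X]Ie -EFinM.
have mb : measurable_fun setT (fun y => ln (1 / v y))%R.
  apply: (measurableT_comp (@measurable_ln R)); apply: measurable_funM.
    exact: measurable_cst.
  exact: measurable_fun_inv_ge0.
have ma : measurable_fun (eball (enorm x)) a.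
  by apply/measurable_EFinP; exact: measurable_int ia.
rewrite /geomean -[vball n (enorm x)]/(radvol x).
rewrite (_ : \int[mu]_(y in eball (enorm x)) (ln (test_fun T y))%:E =
    \int[mu]_(y in eball (enorm x)) (a y + ln (1 / v y)%R)%:E); last first.
  apply: ae_eq_integral; first exact: mB.
  - apply/measurable_EFinP; apply: measurable_funTS.
    by apply: (measurableT_comp (@measurable_ln R)); exact: measurable_test_fun.
  - apply/measurable_EFinP; apply: measurable_funD; first exact: ma.
    exact: measurable_funTS.
  - apply: filterS v_gt0 => y vy _; rewrite /test_fun vy; congr (_%:E).
    have e0 := extremal_gt0 s T0 y.
    by rewrite ln_div ?posrE ?powR_gt0// ln_powR !div1r lnV ?posrE.
rewrite (expeR_average_split ia mb Ia); congr (_%:E * _).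
exact: expR_ln_powR.
Qed.

Lemma geomean_ineq_Dconst (C : R) : (0 < C)%R -> geomean_ineq p q v w C ->
  Dconst s p q v w <= (C * mass `^ (1 / p))%:E.
Proof.
move=> C0 HC; apply: ge_ereal_sup => _ [t /= t0 <-].
set T := vball n t; have T0 : (0 < T)%R by rewrite vball_gt0.
set Ta := (T `^ ((s - 1) / p))%R; have Ta0 : (0 < Ta)%R by rewrite powR_gt0.
apply: le_trans (_ : vnorm setT q w (geomean (test_fun T)) <= _); last first.
  apply: le_trans (HC _ (measurable_test_fun T0) (fun y => test_fun_gt0 y T0)) _.
  by rewrite EFinM; apply: lee_wpmul2l; [rewrite lee_fin ltW|exact: vnorm_test_fun].
apply: le_ereal_inf_tmp => _ [l [l0 hl] <-].
rewrite -lee_pdivlMl//= -EFinM; apply: ereal_inf_lbound.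
exists (Ta^-1 * l)%R => //; split; first by rewrite mulr_gt0 ?invr_gt0.
apply: le_trans hl.
apply: (@le_trans _ _ (\int[mu]_(x in [set x | (t < enorm x)%R])
   (`|geomean (test_fun T) x * (w x)%:E * (l^-1)%:E| `^ q x))); last first.
  apply: ge0_subset_integral.
  - exact: measurable_gt_enorm.
  - exact: measurableT.
  - apply: measurable_modular; [exact: mq|exact: mw|].
    by apply: measurable_geomean; exact: measurable_test_fun.
  - by move=> x _; exact: poweR_ge0.
  - exact: subsetT.
rewrite le_eqVlt; apply/orP; left; apply/eqP; apply: eq_integral => x.
rewrite inE/= => tx; congr (`|_| `^ _).
rewrite geomean_test_fun// mule1 powRN.
rewrite [LHS]muleAC [in RHS]muleAC -[in RHS]muleA [in RHS]muleAC.
rewrite -!EFinM; congr (_%:E * _).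
have X0 : (0 < radvol x `^ (s / p))%R.
  by rewrite powR_gt0// vball_gt0; exact: lt_trans tx.
rewrite -[vball n (enorm x)]/(radvol x) -/T -/Ta.
move: (radvol x `^ (s / p))%R X0 Ta Ta0 => X X0 a a0.
by field; rewrite !gt_eqF.
Qed.

End necessity.
(** * Best constants *)

Section constants.
Context {R : realType} {n : nat}.
Notation mu := (lebesgue_n R n).
Implicit Types q : Rn R n -> R.

(** Otherwise the whole space would be negligible. *)
Lemma ess_inf_le_ess_sup (g : Rn R n -> \bar R) : ess_inf mu g <= ess_sup mu g.
Proof.
rewrite leNgt; apply/negP => lt_se.
have [N [mN N0 subN]] : {ae mu, forall x : Rn R n, False}.
  apply: filterS2 (ess_inf_le mu g) (ess_sup_ge mu g) => x le_i le_s.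
  by move: (le_trans le_i le_s); rewrite leNgt lt_se.
have := @lebesgue_n_setT_gt0 R n.
have -> : [set: Rn R n] = N by apply/seteqP; split => // x _; exact: subN.
by rewrite -[X in _ < X]/(mu N) N0 ltxx.
Qed.

Lemma qinf_qsup_bounds p q : (0 < p)%R -> {ae mu, forall x, (p <= q x)%R} ->
  ess_sup mu (fun x => (q x)%:E) < +oo ->
  (p <= qinf q)%R /\ (qinf q <= qsup q)%R.
Proof.
move=> p0 pq supoo.
have p_inf : p%:E <= ess_inf mu (fun x => (q x)%:E).
  by apply/ess_infP; apply: filterS pq => x; rewrite lee_fin.
have inf_sup := ess_inf_le_ess_sup (fun x => (q x)%:E).
have Ef : ess_inf mu (fun x => (q x)%:E) \is a fin_num.
  rewrite fin_numE gt_eqF ?(lt_le_trans (ltNyr p))//=.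
  by rewrite lt_eqF// (le_lt_trans inf_sup).
have Sf : ess_sup mu (fun x => (q x)%:E) \is a fin_num.
  rewrite fin_numE gt_eqF ?(lt_le_trans (ltNyr p)) ?(le_trans p_inf)//=.
  by rewrite lt_eqF.
by rewrite /qinf /qsup -!lee_fin !fineK.
Qed.

Lemma upper_constant_ge1 p q : (0 < p)%R -> {ae mu, forall x, (p <= q x)%R} ->
  ess_sup mu (fun x => (q x)%:E) < +oo ->
  (1 <= (p / qinf q + (qsup q - p) / qsup q) `^ (2 / p))%R.
Proof.
move=> p0 pq supoo; have [p_inf inf_sup] := qinf_qsup_bounds p0 pq supoo.
have i0 : (0 < qinf q)%R by exact: lt_le_trans p_inf.
have S0 : (0 < qsup q)%R by exact: lt_le_trans inf_sup.
have base : (1 <= p / qinf q + (qsup q - p) / qsup q)%R.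
  rewrite mulrBl divff ?gt_eqF// addrCA lerDl subr_ge0.
  by rewrite ler_pM2l// lef_pV2.
rewrite -[leLHS](powRr0 (p / qinf q + (qsup q - p) / qsup q)).
by rewrite ler_powR// divr_ge0// ltW.
Qed.

Lemma lower_constantE (p s : R) : (0 < p)%R -> (1 < s)%R ->
  (expR (s / p) / (expR s + 1 / (s - 1)) `^ (1 / p) *
    (1 + expR (- s) / (s - 1)) `^ (1 / p) = 1)%R.
Proof.
move=> p0 s1; have s0 : (0 < s - 1)%R by rewrite subr_gt0.
have m0 : (0 < 1 + expR (- s) / (s - 1))%R.
  by rewrite addr_gt0// divr_gt0// expR_gt0.
have -> : (expR s + 1 / (s - 1) = expR s * (1 + expR (- s) / (s - 1)))%R.
  by rewrite mulrDr mulr1 mulrA -expRD subrr expR0.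
rewrite powRM ?expR_ge0 ?(ltW m0)//.
have -> : (expR s `^ (1 / p) = expR (s / p))%R.
  by rewrite /powR gt_eqF ?expR_gt0// expRK mulrC mulrA mulr1.
by field; rewrite !gt_eqF ?expR_gt0 ?powR_gt0.
Qed.

End constants.

Theorem theorem3 (R : realType) (n : nat) (p : R) (q v w : Rn R n -> R) :
  measurable_fun setT q ->
  (0 < p)%R ->
  {ae lebesgue_n R n, forall x, (p <= q x)%R} ->
  ess_sup (lebesgue_n R n) (fun x => (q x)%:E) < +oo ->
  weight setT v ->
  weight setT w ->
  ((exists C : R, (0 < C)%R /\ geomean_ineq p q v w C) <->
   (exists s : R, (1 < s)%R /\ Dconst s p q v w < +oo)) /\
  (forall C : R, best_constant p q v w C ->
    ereal_sup [set (expR (s / p) / (expR s + 1 / (s - 1)) `^ (1 / p))%:E *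
                   Dconst s p q v w | s in [set s : R | (1 < s)%R]] <= C%:E /\
    C%:E <= ((p / qinf q + (qsup q - p) / qsup q) `^ (2 / p))%:E *
      ereal_inf [set (expR ((s - 1) / p))%:E * Dconst s p q v w
                | s in [set s : R | (1 < s)%R]]).
Proof.
move=> mq p0 pq supoo wv ww.
have [[mv v0 v1] [mw w0 _]] := (wv, ww).
have nec (s C : R) : (1 < s)%R -> (0 < C)%R -> geomean_ineq p q v w C ->
    Dconst s p q v w <= (C * (1 + expR (- s) / (s - 1)) `^ (1 / p))%:E.
  move=> s1 C0 HC; apply: geomean_ineq_Dconst => //.
  - by move=> x; exact: v0.
  - by apply: filterS v1 => x; apply.
have suf (s D : R) : (1 < s)%R -> Dconst s p q v w < D%:E ->
    geomean_ineq p q v w (expR ((s - 1) / p) * D)%R.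
  by move=> s1; exact: Dconst_geomean_ineq.
split; [split|].
- move=> [C [C0 HC]]; exists 2%R; split; first by rewrite ltr1n.
  by apply: le_lt_trans (nec _ _ _ C0 HC) _; rewrite ?ltr1n ?ltry.
- move=> [s [s1 Doo]]; have D0 := Dconst_ge0 s p q v w.
  exists (expR ((s - 1) / p) * (fine (Dconst s p q v w) + 1))%R; split.
    by rewrite mulr_gt0 ?expR_gt0// ltr_wpDl// fine_ge0.
  by apply: suf => //; rewrite EFinD fineK ?ge0_fin_numE// lteDl ?ge0_fin_numE// lte01.
- move=> C [C0 HC minC]; split.
    apply: ge_ereal_sup => _ [s /= s1 <-].
    apply: le_trans (lee_wpmul2l _ (nec _ _ s1 C0 HC)) _.
      by rewrite lee_fin divr_ge0 ?expR_ge0 ?powR_ge0.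
    by rewrite -EFinM mulrCA lower_constantE// mulr1.
  set I := ereal_inf _.
  have CI : C%:E <= I.
    apply: le_ereal_inf_tmp => _ [s /= s1 <-].
    have D0 := Dconst_ge0 s p q v w.
    rewrite -lee_pdivrMl ?expR_gt0//.
    apply/lee_addgt0Pr => e e0.
    have [Doo|Dfin] := eqVneq (Dconst s p q v w) +oo.
      by rewrite Doo addye ?leey.
    have DE : Dconst s p q v w = (fine (Dconst s p q v w))%:E.
      by rewrite fineK// ge0_fin_numE// ltey.
    rewrite lee_pdivrMl ?expR_gt0// DE -EFinD -EFinM lee_fin.
    apply: minC.
      by rewrite mulr_gt0 ?expR_gt0// ltr_wpDl// fine_ge0.
    by apply: suf => //; rewrite [X in X < _]DE lte_fin ltrDl.
  have I0 : 0 <= I by apply: le_trans CI; rewrite lee_fin ltW.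
  apply: le_trans CI _; rewrite -[leLHS]mul1e; apply: lee_wpmul2r => //.
  by rewrite lee_fin upper_constant_ge1.
Qed.
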